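(* Let $\mathbf{x}$ be an $n$-periodic trajectory of a discrete Lagrangian system on an $m$-dimensional manifold with Poincaré map $P:W\to W$. Suppose that $V=\operatorname{Ker}(P-I)$ is isotropic, $\dim V=k$, and that $N=\operatorname{Ker}(P-I)^{2m}$ has dimension $2k$. Suppose that the matrices $G_i$ (for all $i$), $\overline G$ and $A^\perp$ are nondegenerate. Then (a) $\widehat Y=\widehat\Omega\oplus\widehat Y^0$ and $X^\perp=\Omega^\perp\oplus X_0^\perp$; (b) the maps $\widehat\Pi|_{\widehat\Omega}:\widehat\Omega\to\Omega^\perp$ and $\widehat\Pi|_{\widehat Y^0}:\widehat Y^0\to X_0^\perp$ are linear isomorphisms; (c) $h|_{Y^0}=h^\perp|_{X_0^\perp}\circ\Pi|_{Y^0}$ and $\hat h|_{\widehat Y^0}=h^\perp|_{X_0^\perp}\circ\widehat\Pi|_{\widehat Y^0}$; (d) for any $\mathbf{u}\in Y^0$ and $\alpha,\beta=1,\dots,k$, $\ h(\widehat{\mathbf{q}}_\alpha,\mathbf{u})=0$ and $h(\widehat{\mathbf{q}}_\alpha,\widehat{\mathbf{q}}_\beta)=a_{\alpha\beta}$; (e) for any $\mathbf{u}^\perp\in\Pi Y^0$ and $\alpha,\beta=1,\dots,k$, $\ h^\perp(\mathbf{q}_\alpha^\perp,\mathbf{u}^\perp)=0$ and $h^\perp(\mathbf{q}_\alpha^\perp,\mathbf{q}_\beta^\perp)=a^\perp_{\alpha\beta}$.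
   Context: Summation over repeated Greek indices from $1$ to $k$ is assumed. For a discrete Lagrangian $L$ on $M\times M$ and an $n$-periodic trajectory $\mathbf{x}=(x_i)$ (i.e. $x_{i+n}=x_i$ and $\partial_2L(x_{i-1},x_i)+\partial_1L(x_i,x_{i+1})=0$), put $E_i=T_{x_i}M$, $A_i=\partial_{22}L(x_{i-1},x_i)+\partial_{11}L(x_i,x_{i+1}):E_i\to E_i^*$ (symmetric), $B_i=-\partial_1\partial_2L(x_i,x_{i+1}):E_i\to E_{i+1}^*$, assumed nondegenerate. Trajectories of the variational system are sequences $u_i\in E_i$, $i\in\mathbb{Z}$, with $A_iu_i-B_{i-1}u_{i-1}-B_i^*u_{i+1}=0$; $W$ is the space of them (identified with pairs $(u_0,u_1)$), $P:(u_0,u_1)\mapsto(u_n,u_{n+1})$, and $\omega(\mathbf{u},\mathbf{v})=\langle B_ju_j,v_{j+1}\rangle-\langle B_jv_j,u_{j+1}\rangle$ (independent of $j$) is the $P$-invariant symplectic form. $X=E_1\times\dots\times E_n$ is identified with $n$-periodic sequences, and $h(\mathbf{u},\mathbf{v})=\sum_{i=1}^n\langle A_iu_i-B_{i-1}u_{i-1}-B_i^*u_{i+1},v_i\rangle$ on $X$. Let $w^1,\dots,w^k$ be a basis of $V$, $\mathbf{w}^\alpha=(w_i^\alpha)$ the corresponding $n$-periodic trajectories, $\Gamma=\operatorname{span}(\mathbf{w}^1,\dots,\mathbf{w}^k)\subset X$. Put $G_i=(g_i^{\alpha\beta})$, $g_i^{\alpha\beta}=\langle B_iw_i^\alpha,w_{i+1}^\beta\rangle$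 (symmetric), $(g_{\alpha\beta i})=G_i^{-1}$, $\overline G=\sum_{i=1}^nG_i^{-1}=(\bar g_{\alpha\beta})$, $(\kappa^{\alpha\beta})=\overline G^{-1}$, and $I_j^\alpha(u_j,u_{j+1})=\langle B_jw_j^\alpha,u_{j+1}\rangle-\langle B_ju_j,w_{j+1}^\alpha\rangle$, $I_j=(I_j^1,\dots,I_j^k)$. Spaces: $Y=\{\mathbf{u}\in X:I_1(u_1,u_2)=\dots=I_n(u_n,u_1)\}$, $Y^0=\{\mathbf{u}\in X:I_i(u_i,u_{i+1})=0\ \forall i\}$, $Z=\{\mathbf{v}\in X:v_i\in\operatorname{span}(w_i^1,\dots,w_i^k)\ \forall i\}$; $\widehat X=X/\Gamma$, $\widehat Y=Y/\Gamma$, and $\widehat Y^0$ is the image of $Y^0$ in $\widehat X$. Since $h(\Gamma,\cdot)=0$, $h$ induces a form $\hat h$ on $\widehat X$; $h$ applied to elements of $\widehat Y$ means $\hat h$. $E_i^\perp=\{u\in E_i:\langle B_{i-1}w_{i-1}^\alpha,u\rangle=0\ \forall\alpha\}$, $X^\perp=E_1^\perp\times\dots\times E_n^\perp\subset X$, $\Pi\mathbf{u}=(\Pi_iu_i)$ with $\Pi_iu=u-g_{\alpha\beta\,i-1}\langle B_{i-1}w_{i-1}^\alpha,u\rangle w_i^\beta$ (also applied to non-periodic sequences). $\Pi:X\to X^\perp$ vanishes on $\Gamma$ and induces $\widehat\Pi:\widehat X\to X^\perp$. $X_0^\perp=\Pi Y^0$. On $X^\perp$, $h^\perp(\mathbf{v},\mathbf{v})=h(\mathbf{v},\mathbf{v})-\sum_{i=1}^ng_{\alpha\beta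 i}\langle B_iv_i,w_{i+1}^\alpha\rangle\langle B_iv_i,w_{i+1}^\beta\rangle$. For a form $f$ and a linear map $\ell$, $f\circ\ell$ denotes the pulled back form $f(\ell\cdot,\ell\cdot)$. For $\mathbf{v}\in X$ there is $\mathbf{u}\in Y$, unique modulo $\Gamma$, with $\mathbf{u}-\mathbf{v}\in Z$; $\Phi:X\to\widehat Y$ sends $\mathbf{v}$ to the class of $\mathbf{u}$. Under the hypotheses $N=\operatorname{Ker}(P-I)^2$ is symplectic with Lagrangian subspace $V$. Let $q_1,\dots,q_k$ be the basis in a Lagrangian complement of $V$ in $N$ with $\omega(w^\alpha,q_\beta)=\delta^\alpha_\beta$, $\omega(q_\alpha,q_\beta)=0$, and let $\mathbf{q}_\alpha=(q_{\alpha i})$ be the corresponding (non-periodic) trajectories. Then $Pq_\alpha=q_\alpha+s_{\alpha\beta}w^\beta$ with $S=(s_{\alpha\beta})$ symmetric, $a_{\alpha\beta}=s_{\alpha\delta}\kappa^{\delta\varepsilon}s_{\varepsilon\beta}-s_{\alpha\beta}$, $a^\perp_{\alpha\beta}=s_{\alpha\beta}-\bar g_{\alpha\beta}$, $A^\perp=(a^\perp_{\alpha\beta})$. The sequences $\mathbf{q}_\alpha^\perp=\Pi\mathbf{q}_\alpha$ are $n$-periodic, so $\mathbf{q}_\alpha^\perp\in X^\perp$; $\widehat{\mathbf{q}}_\alpha=\Phi\mathbf{q}_\alpha^\perp\in\widehat Y$; $\Omega^\perp=\operatorname{span}(\mathbf{q}_1^\perp,\dots,\mathbf{q}_k^\perp)\subset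 X^\perp$, $\widehat\Omega=\operatorname{span}(\widehat{\mathbf{q}}_1,\dots,\widehat{\mathbf{q}}_k)\subset\widehat Y$. *)

(* Defs.v *)
From HB Require Import structures.
From mathcomp Require Import all_boot all_order all_algebra.
From mathcomp Require Import all_classical all_reals all_analysis.
Set Implicit Arguments.
Unset Strict Implicit.
Unset Printing Implicit Defensive.
Import Order.TTheory GRing.Theory Num.Theory.
Import numFieldNormedType.Exports.
Local Open Scope classical_set_scope.
Local Open Scope ring_scope.

Section Differentiability.
Variable R : realType.

(* f is of class C^k on the open set U: all directional derivatives up to
   order k exist and are continuous on U. *)
Fixpoint class_C (k : nat) (V W : normedModType R) (U : set V) (f : V -> W)
    : Prop :=
  (forall p, U p -> {for p, continuous f}) /\
  (if k is k'.+1 then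
     forall v : V, (forall p, U p -> derivable f p v) /\ class_C k' U ('D_v f)
   else True).

Definition smooth_on (V W : normedModType R) (U : set V) (f : V -> W) : Prop :=
  forall k : nat, class_C k U f.

(* An m-dimensional manifold. The atlas is indexed by the points of M: every
   point x comes with a preferred chart [chart x] around it, defined on
   [chart_dom x], with inverse [chart_inv x] on the image. The tangent space
   T_x M is then R^m (row vectors), in the coordinates of [chart x]. *)
Record manifold (m : nat) (M : topologicalType) := Manifold {
  manifold_hausdorff : hausdorff_space M;
  manifold_countable : @second_countable M;
  chart_dom : M -> set M;
  chart : M -> M -> 'rV[R]_m;
  chart_inv : M -> 'rV[R]_m -> M;
  chart_dom_open : forall x, open (chart_dom x);
  chart_dom_center : forall x, chart_dom x x;
  chart_img_open : forall x, open (chart x @` chart_dom x);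
  chartK : forall x y, chart_dom x y -> chart_inv x (chart x y) = y;
  chart_continuous : forall x, {within chart_dom x, continuous (chart x)};
  chart_inv_continuous : forall x,
    {within chart x @` chart_dom x, continuous (chart_inv x)};
  chart_transition : forall x y,
    smooth_on (chart x @` (chart_dom x `&` chart_dom y))
              (chart y \o chart_inv x)
}.

End Differentiability.

Section DiscreteLagrangian.
Variables (R : realType) (m : nat) (M : topologicalType).
Variables (mfd : manifold R m M) (L : M -> M -> R).

Definition local_lagrangian (x y : M) (p : 'rV[R]_m * 'rV[R]_m) : R :=
  L (chart_inv mfd x p.1) (chart_inv mfd y p.2).

Definition discrete_lagrangian : Prop :=
  forall x y, class_C 2 ((chart mfd x @` chart_dom mfd x) `*`
                         (chart mfd y @` chart_dom mfd y))
                        (local_lagrangian x y).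

Definition vec1 (v : 'rV[R]_m) : 'rV[R]_m * 'rV[R]_m := (v, 0).
Definition vec2 (v : 'rV[R]_m) : 'rV[R]_m * 'rV[R]_m := (0, v).

Definition center (x y : M) : 'rV[R]_m * 'rV[R]_m :=
  (chart mfd x x, chart mfd y y).

(* The covectors d_1 L(x, y) on T_x M and d_2 L(x, y) on T_y M. *)
Definition d1L (x y : M) (v : 'rV[R]_m) : R :=
  'D_(vec1 v) (local_lagrangian x y) (center x y).
Definition d2L (x y : M) (v : 'rV[R]_m) : R :=
  'D_(vec2 v) (local_lagrangian x y) (center x y).

Definition periodic_trajectory (n : nat) (x : int -> M) : Prop :=
  (forall i, x (i + n%:Z) = x i) /\
  (forall i v, d2L (x (i - 1)) (x i) v + d1L (x i) (x (i + 1)) v = 0).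

Let e (a : 'I_m) : 'rV[R]_m := delta_mx 0 a.

(* Second partial derivatives of L at (x, y), in the charts at x and y. *)
Definition d11L (x y : M) : 'M[R]_m := \matrix_(a, b)
  'D_(vec1 (e a)) ('D_(vec1 (e b)) (local_lagrangian x y)) (center x y).
Definition d22L (x y : M) : 'M[R]_m := \matrix_(a, b)
  'D_(vec2 (e a)) ('D_(vec2 (e b)) (local_lagrangian x y)) (center x y).
Definition d12L (x y : M) : 'M[R]_m := \matrix_(a, b)
  'D_(vec1 (e a)) ('D_(vec2 (e b)) (local_lagrangian x y)) (center x y).

Definition opA (x : int -> M) (i : int) : 'M[R]_m :=
  d22L (x (i - 1)) (x i) + d11L (x i) (x (i + 1)).
Definition opB (x : int -> M) (i : int) : 'M[R]_m :=
  - d12L (x i) (x (i + 1)).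

End DiscreteLagrangian.

(* Vectors and covectors are rows. An operator C : E -> E'^* is the matrix with
   <C u, v> = u *m C *m v^T; so C u is the row u *m C and C^* v is v *m C^T. *)
Definition pairing (R : realType) (m : nat) (C : 'M[R]_m) (u v : 'rV[R]_m) : R :=
  (u *m C *m v^T) 0 0.

Section Linearization.
Variables (R : realType) (m : nat) (A B : int -> 'M[R]_m).
Notation E := ('rV[R]_m).
Notation W := ('rV[R]_m * 'rV[R]_m)%type.

Definition variation (u : int -> E) (i : int) : E :=
  u i *m A i - u (i - 1) *m B (i - 1) - u (i + 1) *m (B i)^T.

Definition variational_trajectory (u : int -> E) : Prop :=
  forall i, variation u i = 0.

(* The trajectory of the variational system with initial data (u_0, u_1); it
   exists and is unique when all B i are invertible. *)
Definition traj (p : W) : int -> E :=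
  xget (fun=> 0) [set u : int -> E |
    variational_trajectory u /\ (u 0, u 1) = p].

Definition poincare (n : nat) : 'End(W) :=
  linfun (fun p : W => (traj p n%:Z, traj p (n%:Z + 1))).

Definition omega (p q : W) : R :=
  pairing (B 0) p.1 q.2 - pairing (B 0) q.1 p.2.

End Linearization.

Definition ker_pow (R : realType) (m : nat) (T : 'End(('rV[R]_m * 'rV[R]_m)%type))
    (r : nat) : {vspace ('rV[R]_m * 'rV[R]_m)%type} :=
  lker (iter r (fun f => (T \o f)%VF) \1%VF).

(* Subspaces and operators are built from [linfun f], where f is a linear map
   given as a plain function; then [linfun f] has the same values as f. *)

(* The ordinal j : 'I_n stands for the factor E_(j+1) of X = E_1 x ... x E_n. *)
Section Periodic.
Variables (R : realType) (m n : nat).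
Notation E := ('rV[R]_m).
Notation X := {ffun 'I_n -> 'rV[R]_m}.

(* The n-periodic sequence of an element of X (for n > 0). *)
Definition ext (u : X) (i : int) : E :=
  oapp u 0 (insub `|((i - 1) %% n)%Z|%N).

Definition restr (u : int -> E) : X := [ffun j : 'I_n => u (j.+1)%:Z].

Definition h (A B : int -> 'M[R]_m) (u v : X) : R :=
  \sum_(1 <= i < n.+1)
     (variation A B (ext u) i%:Z *m (ext v i%:Z)^T) 0 0.

Variables (k : nat) (B : int -> 'M[R]_m) (w : 'I_k -> int -> E).

Definition Gamma : {vspace X} := <<[seq restr (w a) | a : 'I_k]>>%VS.

Definition G (i : int) : 'M[R]_k :=
  \matrix_(a, b) pairing (B i) (w a i) (w b (i + 1)).

Definition Gbar : 'M[R]_k := \sum_(1 <= i < n.+1) invmx (G i%:Z).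

Definition kappa : 'M[R]_k := invmx Gbar.

Definition integrals (j : int) (u : int -> E) : 'rV[R]_k :=
  \row_a (pairing (B j) (w a j) (u (j + 1)) - pairing (B j) (u j) (w a (j + 1))).

Definition Y : {vspace X} := (\bigcap_(j < n)
  lker (linfun (fun u : X =>
    (integrals (j.+1)%:Z (ext u) - integrals 1 (ext u))%R)))%VS.

Definition Y0 : {vspace X} := (\bigcap_(j < n)
  lker (linfun (fun u : X => integrals (j.+1)%:Z (ext u))))%VS.

Definition Z : {vspace X} := (\bigcap_(j < n)
  (linfun (fun v : X => ext v (j.+1)%:Z)
     @^-1: <<[seq w a (j.+1)%:Z | a : 'I_k]>>))%VS.

Definition Xperp : {vspace X} := (\bigcap_(j < n)
  lker (linfun (fun u : X => (\row_(a < k)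
    pairing (B j%:Z) (w a j%:Z) (ext u (j.+1)%:Z))%R : 'rV[R]_k)))%VS.

Definition Pi_seq (u : int -> E) (i : int) : E :=
  u i - \sum_(a < k) \sum_(b < k)
    (invmx (G (i - 1)) a b * pairing (B (i - 1)) (w a (i - 1)) (u i)) *: w b i.

Definition Pi : 'End(X) := linfun (fun u : X => restr (Pi_seq (ext u))).

Definition X0perp : {vspace X} := (Pi @: Y0)%VS.

(* The symmetric bilinear form whose quadratic form is h^perp(v, v). *)
Definition hperp (A : int -> 'M[R]_m) (u v : X) : R :=
  h A B u v - \sum_(1 <= i < n.+1) \sum_(a < k) \sum_(b < k)
    invmx (G i%:Z) a b
    * pairing (B i%:Z) (ext u i%:Z) (w a (i%:Z + 1))
    * pairing (B i%:Z) (ext v i%:Z) (w b (i%:Z + 1)).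

End Periodic.

(* [pi : X -> Q] realizes Q as the quotient space X / U. *)
Definition is_quotient (R : realType) (X Q : vectType R) (pi : 'Hom(X, Q))
    (U : {vspace X}) : Prop :=
  lker pi = U /\ limg pi = fullv.

Section Quotient.
Variables (R : realType) (X Q : vectType R) (pi : 'Hom(X, Q)).

(* For pi onto, pi^-1 is a linear section of pi; the form (resp. map) induced
   on the quotient does not depend on it when f (resp. l) vanishes on lker pi. *)
Definition induced_form (f : X -> X -> R) (a b : Q) : R :=
  f ((pi^-1)%VF a) ((pi^-1)%VF b).

Definition induced_map (T : vectType R) (l : 'Hom(X, T)) : 'Hom(Q, T) :=
  (l \o pi^-1)%VF.

(* The class of a chosen u in U with u - v in U'; when two such u differ by an
   element of lker pi, the choice is irrelevant. *)
Definition class_near (U U' : {vspace X}) (v : X) : Q :=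
  pi (xget 0 [set u : X | (u \in U) && (u - v \in U')]).

End Quotient.

Definition restricts_to_iso (R : realType) (T T' : vectType R)
    (f : 'Hom(T, T')) (U : {vspace T}) (U' : {vspace T'}) : Prop :=
  {in U &, injective f} /\ (f @: U)%VS = U'.

Definition direct_sum (R : realType) (T : vectType R)
    (U U1 U2 : {vspace T}) : Prop :=
  (U1 + U2)%VS = U /\ directv (U1 + U2).

(* Main.v *)
Require Import Defs.
From HB Require Import structures.
From mathcomp Require Import all_boot all_order all_algebra.
From mathcomp Require Import all_classical all_reals all_analysis.
From mathcomp Require Import ring.
Set Implicit Arguments.
Unset Strict Implicit.
Unset Printing Implicit Defensive.
Import Order.TTheory GRing.Theory Num.Theory.
Import numFieldNormedType.Exports.
Local Open Scope ring_scope.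

(** The quadratic form of the second variation is reduced along the symmetries
    [w a] of the linearized system. Write [frame i] for the matrix with rows
    [w a i] and, for coefficients [c i], let [comb c] be the sequence
    [c i *m frame i]. Everything rests on two formulas, in which only the
    increments of [c] occur:

    - [integrals_comb]: the integrals of [comb c] are
      [(c (i + 1) - c i) *m G i];
    - [hseq_comb]: [h (comb c, y)] is the sum over a period of
      [(c (i + 1) - c i)] paired with the integrals of [y]; it also holds when
      [c] is not periodic but its increments are.

    By the first formula the integrals of a periodic sequence become constant
    after adding some [comb c], where [c] is periodic and unique up to a
    constant because [Gbar] is invertible. Hence [Pi], which removes the [comb]
    part of a sequence, maps [Y] onto [Xperp] with kernel [Gamma] ([limg_Pi_Y],
    [Y_cap_ker]). By the second one, for [u] and [v] in [Y] with integrals [I]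
    and [J], [hperp (Pi u, Pi v) = h (u, v) - I Gbar J^T] ([hperp_Pi]); so
    [h] and [hperp] agree on [Y0], where [I = J = 0].

    Next, [q a] is made periodic by adding [comb c], where the increments of [c]
    are [- row a S *m kappa *m invmx (G i)]: over a period they add up to
    [- row a S], which compensates [P q - q] ([lift_exists]). The periodic
    sequence [lift a] so obtained represents [qhat a] and has integrals
    [row a (1 - S kappa)]. Since [1 - S kappa = - Aperp kappa] is invertible, the
    integrals identify the span of the [lift a] with a complement of [Y0] in
    [Y], and applying [pi] and [Pi] to this decomposition gives the two direct
    sums and the isomorphisms between their terms.
    Because [q a] is a trajectory, [hseq_comb] gives
    [h (lift a, y) = - row a S . I] for [y] in [Y] with integrals [I]; the
    orthogonality relations and the two Gram matrices are then computed from
    the integrals.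

    This uses that [A] is symmetric, that is, the symmetry of second derivatives
    ([derive_comm]), and that [P q - q] lies in [V] with a symmetric matrix [S].
    The latter holds as [P] preserves [omega] ([omega_poincare]), a consequence
    of the discrete Green identity [green]. *)

(** * Symmetry of second derivatives *)

Section Schwarz.
Local Open Scope classical_set_scope.
Local Open Scope ring_scope.
Variables (R : realType) (V : normedModType R).
Implicit Types (F : V -> R) (U : set V) (p q u v : V).

Lemma is_derive_line F q v (s : R) : derivable F (q + s *: v) v ->
  is_derive s 1 (fun t : R => F (q + t *: v)) ('D_v F (q + s *: v)).
Proof.
move=> dF.
have E : (fun h : R => h^-1 *: (((fun t : R => F (q + t *: v)) \o shift s) (h *: 1)
            - F (q + s *: v))) =
         (fun h : R => h^-1 *: ((F \o shift (q + s *: v)) (h *: v)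
            - F (q + s *: v))).
  by apply/funext => h /=; rewrite [h *: 1]mulr1 scalerDl addrCA.
by split; [rewrite /derivable E|rewrite /derive E].
Qed.

Lemma MVT_line F q v (t : R) : 0 <= t ->
    (forall s : R, s \in `[0, t] -> derivable F (q + s *: v) v) ->
  exists2 s, s \in `[0, t] & F (q + t *: v) - F q = 'D_v F (q + s *: v) * t.
Proof.
move=> t0 dF.
have dg (s : R) : s \in `[0, t] ->
    is_derive s 1 (fun r : R => F (q + r *: v)) ('D_v F (q + s *: v)).
  by move=> /dF; exact: is_derive_line.
pose g (s : R) := F (q + s *: v).
have H := @MVT_segment R g (fun s => 'D_v F (q + s *: v)) 0 t t0.
have H1 : forall x, x \in `]0, t[ -> is_derive x 1 g ('D_v F (q + x *: v)).
  by move=> s st; apply: dg; exact: subset_itv_oo_cc st.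
have H2 : {within `[0, t], continuous g}.
  by apply: derivable_within_continuous => s /dg[].
have [s st E] := H H1 H2.
by exists s => //; rewrite -[X in _ - F X = _]addr0 -(scale0r v) E subr0.
Qed.

(** A second difference is [t ^ 2] times a mixed second derivative at some
    point of the parallelogram: this is where the order of differentiation
    becomes irrelevant, since the left-hand side is symmetric in [u] and [v]. *)
Lemma second_difference F U p u v (t : R) : 0 <= t ->
    (forall s s' : R, s \in `[0, t] -> s' \in `[0, t] ->
       U (p + s *: u + s' *: v)) ->
    (forall q, U q -> derivable F q v) ->
    (forall q, U q -> derivable ('D_v F) q u) ->
  exists s s', [/\ s \in `[0, t], s' \in `[0, t] &
    F (p + t *: u + t *: v) - F (p + t *: u) - F (p + t *: v) + F p =
    'D_u ('D_v F) (p + s *: u + s' *: v) * t * t].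
Proof.
move=> t0 UP dF ddF.
have t0t : t \in `[0, t] by rewrite in_itv /= t0 lexx.
have z0t : 0 \in `[0, t] by rewrite in_itv /= t0 lexx.
have E0 q : q + 0 *: u = q by rewrite scale0r addr0.
pose g (q : V) := F (q + t *: u) - F q.
have dg (s : R) : s \in `[0, t] -> is_derive (p + s *: v) v g
    ('D_v F (p + t *: u + s *: v) - 'D_v F (p + s *: v)).
  move=> st; apply: is_deriveB; last first.
    by split=> //; apply: dF; rewrite -[p]E0; exact: UP.
  have := dF _ (UP _ _ t0t st).
  (* The increment quotients of a translate of [F] are those of [F]. *)
  have E : (fun h : R => h^-1 *: (((fun q => F (q + t *: u)) \o shift (p + s *: v))
       (h *: v) - F (p + s *: v + t *: u))) =
     (fun h : R => h^-1 *: ((F \o shift (p + t *: u + s *: v)) (h *: v)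
            - F (p + t *: u + s *: v))).
    apply/funext => h /=.
    by rewrite [p + s *: v + _]addrAC -[h *: v + _ + _]addrA
      [p + s *: v + _]addrAC.
  by split; [rewrite /derivable E|rewrite /derive E].
have [|s' s't E'] := @MVT_line g p v t t0; first by move=> s /dg[].
have [|s st E] := @MVT_line ('D_v F) (p + s' *: v) u t t0.
  by move=> s st; apply: ddF; rewrite addrAC; exact: UP.
exists s, s'; split=> //.
rewrite [p + s *: u + _]addrAC -E.
have [_ gE] := dg _ s't.
move: E'; rewrite gE [p + s' *: v + _]addrAC => <-.
by rewrite /g [p + t *: v + _]addrAC; ring.
Qed.

(** Symmetry of second derivatives for a function of class C^2. *)
Lemma derive_comm F U p u v : open U -> U p -> class_C 2 U F ->
  'D_u ('D_v F) p = 'D_v ('D_u F) p.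
Proof.
move=> oU Up [_ C1].
have dF w q : U q -> derivable F q w by move=> Uq; exact: (C1 w).1.
have ddF w w' q : U q -> derivable ('D_w F) q w'.
  by move=> Uq; apply: ((C1 w).2.2 w').1.
have cF w w' : {for p, continuous ('D_w' ('D_w F))}.
  by apply: (((C1 w).2.2 w').2.1 _ Up).
apply/eqP/negPn/negP => neq.
pose e := `|'D_u ('D_v F) p - 'D_v ('D_u F) p| / 2.
have e0 : 0 < e by rewrite divr_gt0 // normr_gt0 subr_eq0.
have nU : \forall q \near p, U q by exact: open_nbhs_nbhs.
have /cvgrPdist_lt /(_ _ e0) n1 := cF v u.
have /cvgrPdist_lt /(_ _ e0) n2 := cF u v.
have near_p : nbhs p (U `&`
    ([set q | `|'D_u ('D_v F) p - 'D_u ('D_v F) q| < e] `&`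
     [set q | `|'D_v ('D_u F) p - 'D_v ('D_u F) q| < e])).
  by apply: filterI; [exact: nU | apply: filterI; [exact: n1 | exact: n2]].
have [r /= r0 Hr] := (nbhs_ballP p _).1 near_p.
(* With [s] and [s'] at most [t = r / K], [p + s u + s' v] stays in the ball of
   radius [r]. *)
pose K := `|u| + `|v| + 1.
have K0 : 0 < K by rewrite ltr_wpDl // addr_ge0.
pose t := r / K.
have t0 : 0 < t by rewrite divr_gt0.
have inr (a b : V) (s s' : R) : `|a| + `|b| + 1 = K ->
    s \in `[0, t] -> s' \in `[0, t] -> ball p r (p + s *: a + s' *: b).
  rewrite !in_itv /= => abK /andP[s0 st] /andP[s'0 s't].
  rewrite -ball_normE /ball_ /= -addrA opprD addrA subrr sub0r normrN.
  apply: (le_lt_trans (ler_normD _ _)); rewrite !normrZ !ger0_norm //.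
  have rE : r = t * (`|a| + `|b| + 1) by rewrite abK /t divfK // gt_eqF.
  rewrite rE; apply: (@le_lt_trans _ _ (t * (`|a| + `|b|))).
    by rewrite mulrDr lerD // ler_wpM2r.
  by rewrite ltr_pM2l // ltrDl.
have K_vu : `|v| + `|u| + 1 = K by rewrite /K [`|v| + _]addrC.
have [s1 [s1' [s1t s1't E1]]] := second_difference (ltW t0)
  (fun s s' st s't => (Hr _ (inr u v s s' erefl st s't)).1)
  (dF v) (ddF v u).
have [s2 [s2' [s2t s2't E2]]] := second_difference (ltW t0)
  (fun s s' st s't => (Hr _ (inr v u s s' K_vu st s't)).1)
  (dF u) (ddF u v).
have [_ [/= D1 _]] := Hr _ (inr u v _ _ erefl s1t s1't).
have [_ [_ /= D2]] := Hr _ (inr v u _ _ K_vu s2t s2't).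
have cancel_tt (a b : R) : a * t * t = b * t * t -> a = b.
  by move=> ab; do 2!apply: (mulIf (lt0r_neq0 t0)).
have E : 'D_u ('D_v F) (p + s1 *: u + s1' *: v) =
         'D_v ('D_u F) (p + s2 *: v + s2' *: u).
  apply: cancel_tt; apply: (etrans (esym E1)); apply: etrans E2.
  by rewrite [p + t *: v + t *: u]addrAC; congr (_ + _); exact: addrAC.
suff : `|'D_u ('D_v F) p - 'D_v ('D_u F) p| < e + e.
  by rewrite -splitr ltxx.
rewrite -E in D2; rewrite distrC in D2.
rewrite -(subrKA ('D_u ('D_v F) (p + s1 *: u + s1' *: v))).
exact: le_lt_trans (ler_normD _ _) (ltrD D1 D2).
Qed.

End Schwarz.

Lemma open_setX (T T' : topologicalType) (C : set T) (D : set T') :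
  open C -> open D -> open (C `*` D)%classic.
Proof.
rewrite !openE => oC oD [a b] [/= /oC Ca /oD Db].
by exists (C, D).
Qed.

Section SymmetryOfA.
Variables (R : realType) (m : nat) (M : topologicalType).
Variables (mfd : manifold R m M) (L : M -> M -> R).
Hypothesis L_C2 : discrete_lagrangian mfd L.
Local Open Scope classical_set_scope.
Local Open Scope ring_scope.

Lemma derive_comm_lagrangian y z u v :
  'D_u ('D_v (local_lagrangian mfd L y z)) (Defs.center mfd y z) =
  'D_v ('D_u (local_lagrangian mfd L y z)) (Defs.center mfd y z).
Proof.
apply: derive_comm (L_C2 y z).
- by apply: open_setX; exact: chart_img_open.
- by split; [exists y | exists z] => //; exact: chart_dom_center.
Qed.

Lemma trmx_d11L y z : (d11L mfd L y z)^T = d11L mfd L y z.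
Proof.
apply/matrixP => a b; rewrite [LHS]mxE [LHS]mxE [RHS]mxE.
exact: derive_comm_lagrangian.
Qed.

Lemma trmx_d22L y z : (d22L mfd L y z)^T = d22L mfd L y z.
Proof.
apply/matrixP => a b; rewrite [LHS]mxE [LHS]mxE [RHS]mxE.
exact: derive_comm_lagrangian.
Qed.

Lemma trmx_opA x i : (opA mfd L x i)^T = opA mfd L x i.
Proof.
have trmxD (C D : 'M[R]_m) : (C + D)^T = C^T + D^T by exact: linearD.
by rewrite /opA trmxD; congr (_ + _); [exact: trmx_d22L | exact: trmx_d11L].
Qed.

End SymmetryOfA.

(** * Linear algebra *)

(** A map known to be linear has an instance of the structure of linear maps. *)
Lemma linear_bundled (R : pzRingType) (U V : lmodType R) (f : U -> V) :
  linear f -> exists F : {linear U -> V}, F =1 f.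
Proof.
move=> lf.
by exists (HB.pack f (GRing.isLinear.Build _ _ _ _ f lf) : {linear U -> V}).
Qed.

Lemma linfunE (R : fieldType) (aT rT : vectType R) (f : aT -> rT) :
  linear f -> linfun f =1 f.
Proof.
move=> /linear_bundled[F FE]; have <- : (F : aT -> rT) = f by exact/funext.
exact: lfunE.
Qed.

Lemma mem_bigcapv (K : fieldType) (vT : vectType K) (I : finType)
    (Us : I -> {vspace vT}) (u : vT) :
  reflect (forall i, u \in Us i) (u \in \bigcap_i Us i)%VS.
Proof.
rewrite memvE; apply: (iffP subv_bigcapP) => H i => [|_]; last by rewrite -memvE.
by rewrite memvE H.
Qed.

Lemma mem_span_family (R : fieldType) (k : nat) (vT : vectType R)
    (f : 'I_k -> vT) (v : vT) :
  reflect (exists c : 'rV[R]_k, v = \sum_a c 0 a *: f a)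
    (v \in <<[seq f a | a : 'I_k]>>%VS).
Proof.
pose F (c : 'rV[R]_k) := \sum_a c 0 a *: f a.
have lF : linear F.
  move=> x c d; rewrite /F scaler_sumr -big_split; apply: eq_bigr => a _ /=.
  by rewrite !mxE scalerDl scalerA.
apply: (iffP idP) => [|[c ->]]; last first.
  by apply: memv_suml => a _; apply/memvZ/memv_span/map_f; rewrite mem_enum.
suff /subvP sub : (<<[seq f a | a : 'I_k]>> <= limg (linfun F))%VS.
  by move=> /sub/memv_imgP[c _ ->]; exists c; rewrite linfunE.
apply/span_subvP => _ /mapP[a _ ->].
have -> : f a = linfun F (delta_mx 0 a).
  rewrite linfunE // /F (bigD1 a) //= !mxE !eqxx scale1r big1 ?addr0 // => b nb.
  by rewrite mxE (negPf nb) andbF scale0r.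
by rewrite memv_img ?memvf.
Qed.

Lemma direct_sum_img (R : realType) (vT rT : vectType R) (f : 'Hom(vT, rT))
    (U U1 U2 : {vspace vT}) :
  direct_sum U U1 U2 -> (U :&: lker f <= U2)%VS ->
  direct_sum (f @: U)%VS (f @: U1)%VS (f @: U2)%VS.
Proof.
move=> [UE /directv_addP dU] ker; split; first by rewrite -limgD UE.
apply/directv_addP/eqP; rewrite -subv0; apply/subvP => x /memv_capP[].
move=> /memv_imgP[u uU1 ->] /memv_imgP[v vU2 fE].
have uvU : u - v \in U.
  by rewrite -UE memvB // ?(subvP (addvSr U1 U2) v) // (subvP (addvSl U1 U2) u).
have : u - v \in (U :&: lker f)%VS.
  by rewrite memv_cap uvU memv_ker linearB /= fE subrr.
move/(subvP ker) => uvU2.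
have : u \in (U1 :&: U2)%VS by rewrite memv_cap uU1 -(subrK v u) memvD.
by rewrite dU memv0 => /eqP ->; rewrite linear0 mem0v.
Qed.

(** * Functions on the integers *)

(** Two-sided induction on the integers. *)
Lemma int_step_ind (Q : int -> Prop) : Q 0 ->
  (forall i, Q i -> Q (i + 1)) -> (forall i, Q (i + 1) -> Q i) -> forall i, Q i.
Proof.
move=> Q0 up down; case=> n.
  by elim: n => // n IH; rewrite -addn1 PoszD; exact: up.
elim: n => [|n IH]; apply: down; first by rewrite NegzE addNr.
have -> // : Negz n.+1 + 1 = Negz n.
by rewrite !NegzE -addn1 PoszD opprD addrNK.
Qed.

(** A first-order recurrence over all integers can be solved from index 0 in
    both directions as soon as each step has a right inverse. *)
Lemma int_rec (T : Type) (f g : int -> T -> T) (p : T) :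
  (forall i, cancel (g i) (f i)) ->
  exists s : int -> T, s 0 = p /\ forall i, s (i + 1) = f i (s i).
Proof.
move=> gK.
pose fix fwd k := if k is l.+1 then f l (fwd l) else p.
pose fix bwd k := if k is l.+1 then g (- l.+1%:Z) (bwd l) else p.
exists (fun i => match i with Posz k => fwd k | Negz k => bwd k.+1 end).
split=> // -[k|k]; first by rewrite -PoszD addn1.
rewrite NegzE; case: k => [|k]; first by rewrite addNr /= gK.
have -> : - k.+2%:Z + 1 = Negz k by rewrite NegzE -addn1 PoszD opprD addrNK.
by rewrite /= gK.
Qed.

Section PeriodicSum.
Variables (R : zmodType) (n : nat).

(** Functions on the integers with period [n]. *)
Definition periodic (T : Type) (f : int -> T) := forall i, f (i + n%:Z) = f i.

Lemma sum_diff (f : int -> R) :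
  \sum_(1 <= i < n.+1) (f i%:Z - f (i%:Z - 1)) = f n%:Z - f 0.
Proof.
rewrite -(telescope_sumr (fun i : nat => f i%:Z)) // big_add1.
by apply: eq_bigr => i _; rewrite -addn1 PoszD addrK.
Qed.

Lemma sum_shift (f : int -> R) : periodic f ->
  \sum_(1 <= i < n.+1) f (i%:Z - 1) = \sum_(1 <= i < n.+1) f i%:Z.
Proof.
move=> pf; apply/esym/eqP; rewrite -subr_eq0 -sumrB sum_diff.
by rewrite -[n%:Z]add0r pf subrr.
Qed.

(** A function with periodic increments is shifted, over a period, by the sum of
    these increments. *)
Lemma sum_step (f : int -> R) : periodic (fun i => f (i + 1) - f i) ->
  forall i, f (i + n%:Z) = f i + \sum_(1 <= j < n.+1) (f (j%:Z + 1) - f j%:Z).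
Proof.
move=> pf; rewrite -(sum_shift pf) (_ : \sum_(_ <= _ < _) _ = f n%:Z - f 0); last first.
  by rewrite -sum_diff; apply: eq_bigr => i _; rewrite subrK.
have step i : f (i + 1 + n%:Z) - f (i + n%:Z) = f (i + 1) - f i.
  by rewrite -(pf i) addrAC.
apply: int_step_ind => [|i E|i E]; first by rewrite add0r subrKC.
  by rewrite -[LHS](subrK (f (i + n%:Z))) step E addrA subrK.
by rewrite -[LHS](subKr (f (i + 1 + n%:Z))) step E opprB addrC -!addrA addKr addrC.
Qed.

Lemma periodic_mulz (T : Type) (f : int -> T) : periodic f ->
  forall i l : int, f (i + l * n%:Z) = f i.
Proof.
move=> pf i; apply: int_step_ind => [|l E|l E]; first by rewrite mul0r addr0.
  by rewrite mulrDl mul1r addrA pf.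
by rewrite -E mulrDl mul1r addrA pf.
Qed.

End PeriodicSum.

(** * The variational system and its Poincare map *)

Local Notation variation := Defs.variation.

Section VariationalSystem.
Variables (R : realType) (m n : nat) (A B : int -> 'M[R]_m).
Hypothesis A_sym : forall i, (A i)^T = A i.
Hypothesis B_unit : forall i, B i \in unitmx.
Hypothesis A_periodic : periodic n A.
Hypothesis B_periodic : periodic n B.
Notation E := 'rV[R]_m.
Notation W := (E * E)%type.
Implicit Types (u v : int -> E) (p : W).

Lemma variation_linear : linear (variation A B : (int -> E) -> int -> E).
Proof.
move=> c u v; apply/funext => i; rewrite /variation !fctE.
rewrite !mulmxDl -!scalemxAl !scalerBr.
by rewrite !opprD [X in X + _ = _]addrACA [LHS]addrACA.
Qed.

HB.instance Definition _ :=
  GRing.isLinear.Build R (int -> E) (int -> E) _ (variation A B) variation_linear.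

(** Initial data [(u 0, u 1)] extend to a trajectory in both directions, as every
    [B i] is invertible. *)
Lemma trajectory_exists p :
  exists u, variational_trajectory A B u /\ (u 0, u 1) = p.
Proof.
(* [s i] stands for the pair [(u i, u (i + 1))]. *)
pose f i (p : W) : W :=
  (p.2, (p.2 *m A (i + 1) - p.1 *m B i) *m invmx (B (i + 1))^T).
pose g i (p : W) : W :=
  ((p.1 *m A (i + 1) - p.2 *m (B (i + 1))^T) *m invmx (B i), p.1).
have fK i : cancel (g i) (f i).
  move=> [a b]; rewrite /f /g /=; congr (_, _).
  by rewrite mulmxKV // opprB addrC subrK mulmxK // unitmx_tr.
have [s [s0 sS]] := int_rec p fK.
have s2 i : (s i).2 = (s (i + 1)).1 by rewrite sS.
exists (fun i => (s i).1); split; last by rewrite -[1]add0r -s2 s0; case: (p).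
move=> i; rewrite /variation; have [j ->] : exists j, i = j + 1.
  by exists (i - 1); rewrite subrK.
have -> : (s (j + 1 + 1)).1 *m (B (j + 1))^T =
          (s (j + 1)).1 *m A (j + 1) - (s j).1 *m B j.
  by rewrite -!s2 sS mulmxKV // unitmx_tr.
by rewrite addrK subrr.
Qed.

Lemma trajectory_eq0 u : variational_trajectory A B u -> u 0 = 0 -> u 1 = 0 ->
  u = 0.
Proof.
move=> tu u0 u1; apply/funext => i.
suff [] : u i = 0 /\ u (i + 1) = 0 by [].
elim/int_step_ind: i => [|i [ui ui1]|i [ui1 ui2]]; first by rewrite add0r.
  split=> //; have := tu (i + 1); rewrite /variation addrK ui ui1 !mul0mx subr0 sub0r.
  move/eqP; rewrite oppr_eq0 => /eqP E0.
  by rewrite -[LHS](@mulmxK _ _ _ (B (i + 1))^T) ?unitmx_tr // E0 mul0mx.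
split=> //; have := tu (i + 1); rewrite /variation addrK ui1 ui2 !mul0mx subr0 sub0r.
move/eqP; rewrite oppr_eq0 => /eqP E0.
by rewrite -[LHS](@mulmxK _ _ _ (B i)) // E0 mul0mx.
Qed.

Lemma traj_spec p :
  variational_trajectory A B (traj A B p) /\ (traj A B p 0, traj A B p 1) = p.
Proof. exact: (xgetPex (fun=> 0) (trajectory_exists p)). Qed.

Lemma traj0 p : traj A B p 0 = p.1.
Proof. by have [_] := traj_spec p; case: p => a b []. Qed.

Lemma traj1 p : traj A B p 1 = p.2.
Proof. by have [_] := traj_spec p; case: p => a b []. Qed.

Lemma trajectoryP u : variational_trajectory A B u <-> variation A B u = 0.
Proof. by split=> [tu|tu i]; [exact/funext | rewrite tu]. Qed.

Lemma variation_traj p : variation A B (traj A B p) = 0.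
Proof. by apply/trajectoryP; case: (traj_spec p). Qed.

Lemma trajectory_unique u v : variation A B u = 0 -> variation A B v = 0 ->
  u 0 = v 0 -> u 1 = v 1 -> u = v.
Proof.
move=> tu tv E0 E1; apply/eqP; rewrite -subr_eq0; apply/eqP.
apply: trajectory_eq0; [|by rewrite !fctE E0 subrr|by rewrite !fctE E1 subrr].
by apply/trajectoryP; rewrite linearB /= tu tv subrr.
Qed.

Lemma traj_linear : linear (traj A B).
Proof.
move=> c p q; apply: trajectory_unique.
- exact: variation_traj.
- by rewrite linearP /= !variation_traj scaler0 addr0.
- by rewrite !fctE !traj0.
- by rewrite !fctE !traj1.
Qed.

Lemma poincareE p : poincare A B n p = (traj A B p n%:Z, traj A B p (n%:Z + 1)).
Proof. by rewrite /poincare linfunE // => c a b; rewrite traj_linear. Qed.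

Lemma variation_shift u i :
  variation A B (fun j => u (j + n%:Z)) i = variation A B u (i + n%:Z).
Proof.
by rewrite /variation -(A_periodic i) -(B_periodic i) -(B_periodic (i - 1))
  ![i + _ + n%:Z]addrAC.
Qed.

(** The Poincare map is the translation by a period on trajectories. *)
Lemma traj_poincare p :
  traj A B (poincare A B n p) = fun i => traj A B p (i + n%:Z).
Proof.
apply: trajectory_unique.
- exact: variation_traj.
- by apply/funext => i; rewrite variation_shift variation_traj.
- by rewrite traj0 poincareE add0r.
- by rewrite traj1 poincareE addrC.
Qed.

Lemma mx11B (M N : 'M[R]_1) : (M - N) 0 0 = M 0 0 - N 0 0.
Proof. by rewrite !mxE. Qed.

Lemma trmx11 (M : 'M[R]_1) : M^T 0 0 = M 0 0.
Proof. by rewrite mxE. Qed.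

Lemma pairing_tr (C : 'M[R]_m) (a b : E) : pairing C^T a b = pairing C b a.
Proof. by rewrite /pairing -[RHS]trmx11 !trmx_mul trmxK mulmxA. Qed.

(** The form omega at the index [j], on sequences. *)
Definition wronskian u v (j : int) : R :=
  pairing (B j) (u j) (v (j + 1)) - pairing (B j) (v j) (u (j + 1)).

Lemma variation_pairing u i (a : E) : (variation A B u i *m a^T) 0 0 =
  pairing (A i) (u i) a - pairing (B (i - 1)) (u (i - 1)) a
  - pairing (B i) a (u (i + 1)).
Proof.
by rewrite -[pairing (B i) _ _]pairing_tr /variation !mulmxBl !mx11B.
Qed.

(** The discrete Green identity. *)
Lemma green u v i :
  (variation A B u i *m (v i)^T) 0 0 - (variation A B v i *m (u i)^T) 0 0 =
  wronskian u v i - wronskian u v (i - 1).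
Proof.
rewrite !variation_pairing -[in pairing (A i) (u i) (v i)]A_sym pairing_tr.
by rewrite /wronskian subrK; ring.
Qed.

Lemma wronskian_const u v : variation A B u = 0 -> variation A B v = 0 ->
  forall i, wronskian u v i = wronskian u v 0.
Proof.
move=> tu tv; have step i : wronskian u v (i + 1) = wronskian u v i.
  have := green u v (i + 1); rewrite addrK tu tv.
  rewrite [(0 : int -> E) _]/(0 : E) !mul0mx subrr => /esym/eqP.
  by rewrite subr_eq0 => /eqP.
by apply: int_step_ind => // i; rewrite step.
Qed.

Lemma omegaE p q : omega B p q = wronskian (traj A B p) (traj A B q) 0.
Proof. by rewrite /omega /wronskian add0r !traj0 !traj1. Qed.

Lemma omega_poincare p q :
  omega B (poincare A B n p) (poincare A B n q) = omega B p q.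
Proof.
rewrite !omegaE; transitivity (wronskian (traj A B p) (traj A B q) n%:Z).
  rewrite !traj_poincare /wronskian add0r [n%:Z + 1]addrC -(B_periodic 0).
  by rewrite add0r.
by apply: wronskian_const; exact: variation_traj.
Qed.

Lemma pairing_linear (C : 'M[R]_m) (a : E) : linear (pairing C a).
Proof. by move=> c x y; rewrite /pairing linearP mulmxDr -scalemxAr !mxE. Qed.

Lemma omega_linear p : linear (omega B p).
Proof.
move=> c x y; rewrite /omega /= !pairing_linear -![pairing _ _ p.2]pairing_tr.
by rewrite !pairing_linear [in RHS]scalerBr opprD addrACA.
Qed.

HB.instance Definition _ p :=
  GRing.isLinear.Build R W R _ (omega B p) (omega_linear p).

Lemma omegaDr p x y : omega B p (x + y) = omega B p x + omega B p y.
Proof. exact: linearD. Qed.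

Lemma omegaBr p x y : omega B p (x - y) = omega B p x - omega B p y.
Proof. exact: linearB. Qed.

Lemma omega_sumr (I : finType) p (c : I -> R) (f : I -> W) :
  omega B p (\sum_i c i *: f i) = \sum_i c i * omega B p (f i).
Proof.
have [F FE] : exists F : {linear W -> R}, F =1 omega B p by exists (omega B p).
rewrite -FE linear_sum; apply: eq_bigr => i _.
by rewrite linearZ /= FE.
Qed.

Lemma omega_antisym p q : omega B p q = - omega B q p.
Proof. by rewrite /omega opprB. Qed.

End VariationalSystem.

(** * Periodic sequences *)

Section PeriodicSequences.
Variables (R : realType) (m n : nat).
Hypothesis n_gt0 : (0 < n)%N.
Notation E := 'rV[R]_m.
Notation X := {ffun 'I_n -> 'rV[R]_m}.

(** Every integer is congruent modulo [n] to some index [j.+1] of a factor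
    of [X]. *)
Lemma int_ordE (i : int) : exists j : 'I_n, exists l : int, i = j.+1%:Z + l * n%:Z.
Proof.
have n0 : n%:Z != 0 by rewrite -lt0n.
have lt : (`|((i - 1) %% n)%Z| < n)%N.
  by rewrite -ltz_nat gez0_abs ?modz_ge0 // ltz_pmod.
exists (Ordinal lt), ((i - 1) %/ n)%Z.
rewrite /= -addn1 PoszD gez0_abs ?modz_ge0 // addrAC addrC -[i in LHS](subrKC 1).
by congr (_ + _); rewrite {1}(divz_eq (i - 1) n) addrC.
Qed.

(** Two periodic functions agree as soon as they agree on [1 .. n]. *)
Lemma periodic_eq (T : Type) (f g : int -> T) : periodic n f -> periodic n g ->
  (forall j : 'I_n, f j.+1%:Z = g j.+1%:Z) -> forall i, f i = g i.
Proof.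
by move=> pf pg fg i; have [j [l ->]] := int_ordE i; rewrite !periodic_mulz.
Qed.

Lemma ext_linear : linear (@ext R m n : X -> int -> E).
Proof.
move=> c u v; apply/funext => i; rewrite !fctE /ext.
by case: insub => [j|] /=; rewrite ?ffunE ?scaler0 ?addr0 // !ffunE.
Qed.

HB.instance Definition _ :=
  GRing.isLinear.Build R X (int -> E) _ (@ext R m n) ext_linear.

Lemma extD (u v : X) : ext (u + v) = ext u + ext v.
Proof. exact: linearD. Qed.

Lemma extB (u v : X) : ext (u - v) = ext u - ext v.
Proof. exact: linearB. Qed.

Lemma ext0 : ext (0 : X) = 0.
Proof. by apply: (addrI (ext (0 : X))); rewrite -extD !addr0. Qed.

Lemma ext_periodic (u : X) : periodic n (ext u).
Proof. by move=> i; rewrite /ext addrAC modzDr. Qed.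

Lemma ext_ord (u : X) (j : 'I_n) : ext u j.+1%:Z = u j.
Proof.
have -> : j.+1%:Z = j%:Z + 1 by rewrite -addn1 PoszD.
rewrite /ext addrK modz_small ?ltz_nat ?ltn_ord //=.
by rewrite valK.
Qed.

Lemma restr_linear : linear (@restr R m n : (int -> E) -> X).
Proof. by move=> c u v; apply/ffunP => j; rewrite !ffunE. Qed.

HB.instance Definition _ :=
  GRing.isLinear.Build R (int -> E) X _ (@restr R m n) restr_linear.

Lemma restr0 : restr n (0 : int -> E) = 0.
Proof. by apply/ffunP => j; rewrite !ffunE. Qed.

Lemma restrK (u : int -> E) : periodic n u -> ext (restr n u) = u.
Proof.
move=> pu; apply/funext; apply: periodic_eq => // [|j]; first exact: ext_periodic.
by rewrite ext_ord ffunE.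
Qed.

Lemma extK (u : X) : restr n (ext u) = u.
Proof. by apply/ffunP => j; rewrite ffunE ext_ord. Qed.

Lemma ext_inj : injective (@ext R m n).
Proof. exact: can_inj extK. Qed.

End PeriodicSequences.

(** * The form of the second variation along the symmetries *)

Section PeriodicVariations.
Variables (R : realType) (m n k : nat) (A B : int -> 'M[R]_m).
Hypothesis n_gt0 : (0 < n)%N.
Hypothesis A_sym : forall i, (A i)^T = A i.
Hypothesis B_periodic : periodic n B.
Notation E := 'rV[R]_m.
Notation X := {ffun 'I_n -> 'rV[R]_m}.
Variable w : 'I_k -> int -> E.
Hypothesis w_periodic : forall a, periodic n (w a).
Hypothesis w_traj : forall a, variation A B (w a) = 0.
Hypothesis w_isotropic : forall a b, wronskian B (w a) (w b) 0 = 0.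
Hypothesis G_unit : forall i, G B w i \in unitmx.
Hypothesis Gbar_unit : Gbar n B w \in unitmx.
Notation G := (G B w).
Notation integrals := (integrals B w).
Notation Pi_seq := (Pi_seq B w).
Implicit Types (u v y : int -> E) (c d : int -> 'rV[R]_k).

(** The vectors [w a i] as the rows of a matrix. *)
Definition frame (i : int) : 'M[R]_(k, m) := \matrix_a w a i.

(** The sequence of combinations of the [w a i] with coefficients [c i]. *)
Definition comb c (i : int) : E := c i *m frame i.

(** The coefficients of [u i] along the [w a i], in the decomposition of the
    tangent space into their span and the orthogonal subspace. *)
Definition coef u (i : int) : 'rV[R]_k :=
  u i *m (B (i - 1))^T *m (frame (i - 1))^T *m invmx (G (i - 1)).

Lemma entry_pairing p (a : 'I_p) l (b : 'I_l) (C : 'M[R]_m) (M : 'M[R]_(p, m))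
    (N : 'M[R]_(l, m)) :
  (M *m C *m N^T) a b = pairing C (row a M) (row b N).
Proof.
rewrite /pairing -!row_mul !mxE; apply: eq_bigr => j _.
by rewrite !mxE.
Qed.

Lemma row_frame a i : row a (frame i) = w a i.
Proof. exact: rowK. Qed.

Lemma G_frame i : G i = frame i *m B i *m (frame (i + 1))^T.
Proof. by apply/matrixP => a b; rewrite entry_pairing !row_frame mxE. Qed.

Lemma integralsE j u : integrals j u =
  u (j + 1) *m (B j)^T *m (frame j)^T - u j *m B j *m (frame (j + 1))^T.
Proof.
apply/rowP => a; rewrite [RHS]mxE [X in _ = _ + X]mxE !entry_pairing !row_frame mxE.
by rewrite !row_id pairing_tr.
Qed.

Lemma integrals_linear j : linear (integrals j : (int -> E) -> 'rV[R]_k).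
Proof.
move=> c u v; rewrite !integralsE !fctE !mulmxDl -!scalemxAl scalerBr opprD.
by rewrite addrACA.
Qed.

HB.instance Definition _ j :=
  GRing.isLinear.Build R (int -> E) 'rV[R]_k _ (integrals j) (integrals_linear j).

Lemma integralsD j u v : integrals j (u + v) = integrals j u + integrals j v.
Proof. exact: linearD. Qed.

Lemma integralsB j u v : integrals j (u - v) = integrals j u - integrals j v.
Proof. exact: linearB. Qed.

Lemma integrals_wronskian j u a : integrals j u 0 a = wronskian B (w a) u j.
Proof. by rewrite mxE. Qed.

(** The integrals of a trajectory are conserved. *)
Lemma integrals_traj u : variation A B u = 0 ->
  forall j, integrals j u = integrals 0 u.
Proof.
move=> tu j; apply/rowP => a; rewrite !integrals_wronskian.
by rewrite (wronskian_const A_sym (w_traj a) tu).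
Qed.

(** [G i] is symmetric because the [w a] span an isotropic subspace. *)
Lemma trmx_G i : (G i)^T = G i.
Proof.
apply/matrixP => a b; rewrite !mxE; apply/eqP; rewrite -subr_eq0; apply/eqP.
rewrite -(w_isotropic b a).
by rewrite -(wronskian_const A_sym (w_traj b) (w_traj a) i).
Qed.

Lemma frame_periodic : periodic n frame.
Proof. by move=> i; apply/row_matrixP => a; rewrite !row_frame w_periodic. Qed.

Lemma G_periodic : periodic n G.
Proof. by move=> i; rewrite !G_frame B_periodic frame_periodic addrAC frame_periodic. Qed.

Lemma integrals_periodic u : periodic n u -> periodic n (integrals ^~ u).
Proof.
by move=> pu i; rewrite !integralsE addrAC !pu B_periodic !frame_periodic.
Qed.

Lemma frame_traj i : frame i *m A i =
  frame (i - 1) *m B (i - 1) + frame (i + 1) *m (B i)^T.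
Proof.
apply/row_matrixP => a; rewrite linearD /= !row_mul !row_frame.
have /eqP := congr1 (fun f => f i) (w_traj a).
by rewrite /variation -addrA -opprD subr_eq0 => /eqP.
Qed.

Lemma integrals_comb c j : integrals j (comb c) = (c (j + 1) - c j) *m G j.
Proof.
rewrite integralsE /comb mulmxBl -{1}(trmx_G j) !G_frame.
by rewrite !trmx_mul trmxK !mulmxA.
Qed.

Lemma coef_comb c i : coef (comb c) i = c i.
Proof.
rewrite /coef /comb -[RHS](mulmxK (G_unit (i - 1))); congr (_ *m _).
by rewrite -(trmx_G (i - 1)) G_frame subrK !trmx_mul trmxK !mulmxA.
Qed.

Lemma Pi_seqE u i : Pi_seq u i = u i - coef u i *m frame i.
Proof.
rewrite /Pi_seq; congr (_ - _).
rewrite mulmx_sum_row exchange_big /=; apply: eq_bigr => b _.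
rewrite row_frame [_ 0 b]mxE scaler_suml; apply: eq_bigr => a _.
by rewrite entry_pairing row_frame row_id pairing_tr mulrC.
Qed.

Lemma coef_linear : linear (coef : (int -> E) -> int -> 'rV[R]_k).
Proof. by move=> c u v; apply/funext => i; rewrite /coef !fctE !mulmxDl -!scalemxAl. Qed.

HB.instance Definition _ :=
  GRing.isLinear.Build R (int -> E) (int -> 'rV[R]_k) _ coef coef_linear.

Lemma Pi_seq_linear : linear (Pi_seq : (int -> E) -> int -> E).
Proof.
move=> c u v; apply/funext => i; rewrite !fctE !Pi_seqE linearP !fctE.
by rewrite mulmxDl -scalemxAl scalerBr opprD addrACA.
Qed.

HB.instance Definition _ :=
  GRing.isLinear.Build R (int -> E) (int -> E) _ Pi_seq Pi_seq_linear.

Lemma Pi_seqD u v : Pi_seq (u + v) = Pi_seq u + Pi_seq v.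
Proof. exact: linearD. Qed.

Lemma Pi_seq_comb c : Pi_seq (comb c) = 0.
Proof. by apply/funext => i; rewrite Pi_seqE coef_comb subrr. Qed.

Lemma coef_periodic u : periodic n u -> periodic n (coef u).
Proof.
move=> pu i; rewrite /coef addrAC.
by rewrite pu B_periodic frame_periodic G_periodic.
Qed.

Lemma comb_periodic c : periodic n c -> periodic n (comb c).
Proof. by move=> pc i; rewrite /comb pc frame_periodic. Qed.

Lemma Pi_seq_periodic u : periodic n u -> periodic n (Pi_seq u).
Proof.
by move=> pu i; rewrite !Pi_seqE pu coef_periodic // frame_periodic.
Qed.

Lemma Pi_seq_decomp u : u = Pi_seq u + comb (coef u).
Proof. by apply/funext => i; rewrite !fctE Pi_seqE subrK. Qed.

Lemma coef_Pi_seq u : coef (Pi_seq u) = 0.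
Proof.
apply/eqP; rewrite -(inj_eq (addIr (coef (comb (coef u))))) -linearD /=.
rewrite -Pi_seq_decomp add0r; apply/eqP/funext => i.
by rewrite coef_comb.
Qed.

Lemma variation_comb c i : variation A B (comb c) i =
  (c i - c (i - 1)) *m frame (i - 1) *m B (i - 1)
  - (c (i + 1) - c i) *m frame (i + 1) *m (B i)^T.
Proof.
rewrite /variation /comb -[c i *m _ *m _]mulmxA frame_traj mulmxDr !mulmxBl.
by rewrite !mulmxA opprB -[LHS]addrA -opprD opprD addrACA.
Qed.

(** The form [h] on sequences which need not be periodic. *)
Definition hseq u v : R :=
  \sum_(1 <= i < n.+1) (variation A B u i%:Z *m (v i%:Z)^T) 0 0.

Lemma hseq_sym u v : periodic n u -> periodic n v -> hseq u v = hseq v u.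
Proof.
move=> pu pv; apply/eqP; rewrite -subr_eq0 -sumrB.
under eq_bigr do rewrite green //.
rewrite sum_diff /wronskian add0r -[n%:Z]add0r B_periodic pu pv.
by rewrite [0 + n%:Z + 1]addrAC pu pv add0r subrr.
Qed.

Lemma hseqDl u1 u2 v : hseq (u1 + u2) v = hseq u1 v + hseq u2 v.
Proof.
rewrite /hseq -big_split; apply: eq_bigr => i _ /=.
have -> : variation A B (u1 + u2) = variation A B u1 + variation A B u2.
  exact: linearD.
by rewrite [(_ + _) _]/(_ + _) mulmxDl mxE.
Qed.

Lemma hseq_traj u v : variation A B u = 0 -> hseq u v = 0.
Proof.
by move=> tu; rewrite /hseq tu big1 // => i _; rewrite mul0mx mxE.
Qed.

(** Only the increments of [c] matter when a variation is moved along the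
    directions of the [w a], and they are paired with the integrals. *)
Lemma hseq_comb c y : periodic n (fun i => c (i + 1) - c i) -> periodic n y ->
  hseq (comb c) y =
  \sum_(1 <= i < n.+1) ((c (i%:Z + 1) - c i%:Z) *m (integrals i%:Z y)^T) 0 0.
Proof.
move=> pc py.
(* Discrete summation by parts: the terms at [i - 1] are shifted to [i]. *)
pose D i := c (i + 1) - c i.
pose F i := pairing (B i) (D i *m frame i) (y (i + 1)).
have pF : periodic n F.
  by move=> i; rewrite /F /D pc B_periodic frame_periodic addrAC py.
transitivity (\sum_(1 <= i < n.+1) (F (i%:Z - 1) -
    pairing (B i%:Z) (y i%:Z) (D i%:Z *m frame (i%:Z + 1)))).
  apply: eq_bigr => i _.
  rewrite variation_comb mulmxBl mx11B /F /D subrK.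
  by rewrite -[pairing (B i%:Z) _ _]pairing_tr.
rewrite sumrB (sum_shift pF) -sumrB; apply: eq_bigr => i _.
rewrite -[RHS]trmx11 trmx_mul trmxK integralsE [in RHS]mulmxBl mx11B /F /D.
by rewrite -pairing_tr /pairing !trmx_mul !mulmxA.
Qed.

Lemma bilinear_formE (M : 'M[R]_k) (x y : 'rV[R]_k) :
  (x *m M *m y^T) 0 0 = \sum_a \sum_b M a b * x 0 a * y 0 b.
Proof.
rewrite exchange_big mxE; apply: eq_bigr => b _ /=; rewrite !mxE mulr_suml.
by apply: eq_bigr => a _; rewrite [M a b * _]mulrC.
Qed.

Lemma sum_mx11 (I : Type) (s : seq I) (F : I -> 'M[R]_1) :
  \sum_(i <- s) F i 0 0 = (\sum_(i <- s) F i) 0 0.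
Proof. by rewrite summxE. Qed.

Lemma sum_increments (T : zmodType) (c : int -> T) : periodic n c ->
  \sum_(1 <= i < n.+1) (c (i%:Z + 1) - c i%:Z) = 0.
Proof.
move=> pc; apply: (@addrI _ (c 0)); rewrite addr0 -sum_step ?pc //.
by move=> i; rewrite addrAC !pc.
Qed.

Lemma hperpE (u v : X) : hperp B w A u v = hseq (ext u) (ext v) -
  \sum_(1 <= i < n.+1)
    (ext u i%:Z *m B i%:Z *m (frame (i%:Z + 1))^T *m invmx (G i%:Z) *m
     (ext v i%:Z *m B i%:Z *m (frame (i%:Z + 1))^T)^T) 0 0.
Proof.
congr (_ - _); apply: eq_bigr => i _; rewrite bilinear_formE.
apply: eq_bigr => a _; apply: eq_bigr => b _.
by rewrite !entry_pairing !row_frame !row_id.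
Qed.

Lemma coef_eq0 u i : coef u i = 0 ->
  u i *m (B (i - 1))^T *m (frame (i - 1))^T = 0.
Proof. by rewrite /coef => E0; rewrite -[LHS](mulmxKV (G_unit (i - 1))) E0 mul0mx. Qed.

Lemma Pi_seq_sub u : Pi_seq u = u - comb (coef u).
Proof. by apply/eqP; rewrite eq_sym subr_eq -Pi_seq_decomp. Qed.

Lemma integrals_Pi_seq u i : integrals i (Pi_seq u) =
  integrals i u - (coef u (i + 1) - coef u i) *m G i.
Proof. by rewrite Pi_seq_sub integralsB integrals_comb. Qed.

(** On orthogonal sequences, the correction term in [hperp] is expressed by the
    integrals, as the other half of them vanishes. *)
Lemma Pi_seq_boundary u i :
  Pi_seq u i *m B i *m (frame (i + 1))^T = - integrals i (Pi_seq u).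
Proof.
have := @coef_eq0 (Pi_seq u) (i + 1); rewrite addrK coef_Pi_seq => /(_ erefl) E0.
by rewrite integralsE E0 sub0r opprK.
Qed.

(** Two periodic sequences with constant integrals [I] and [J], that is, two
    elements of [Y]; [dc] and [dd] are the increments of their coefficients. *)
Section TwoPeriodic.
Variables (u v : int -> E) (I J : 'rV[R]_k).
Hypothesis (pu : periodic n u) (pv : periodic n v).
Hypothesis (uI : forall i, integrals i u = I) (vJ : forall i, integrals i v = J).
Let dc i := coef u (i + 1) - coef u i.
Let dd i := coef v (i + 1) - coef v i.

Let pdc : periodic n dc. Proof. by move=> i; rewrite /dc addrAC !coef_periodic. Qed.
Let pdd : periodic n dd. Proof. by move=> i; rewrite /dd addrAC !coef_periodic. Qed.
Let sdc : \sum_(1 <= i < n.+1) dc i%:Z = 0.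
Proof. exact: sum_increments (coef_periodic pu). Qed.
Let sdd : \sum_(1 <= i < n.+1) dd i%:Z = 0.
Proof. exact: sum_increments (coef_periodic pv). Qed.

Lemma hseq_Pi_seq : hseq (Pi_seq u) (Pi_seq v) =
  hseq u v + (\sum_(1 <= i < n.+1) dc i%:Z *m G i%:Z *m (dd i%:Z)^T) 0 0.
Proof.
have -> : hseq u v = hseq (Pi_seq u) v.
  rewrite {1}[u]Pi_seq_decomp hseqDl hseq_comb //.
  under eq_bigr do rewrite vJ.
  by rewrite sum_mx11 -mulmx_suml sdc mul0mx mxE addr0.
rewrite [in RHS]hseq_sym //; last exact: Pi_seq_periodic.
rewrite {2}[v]Pi_seq_decomp hseqDl hseq_comb //; last exact: Pi_seq_periodic.
rewrite hseq_sym; try exact: Pi_seq_periodic.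
under eq_bigr do rewrite integrals_Pi_seq uI linearB /= mulmxBr.
rewrite sum_mx11 sumrB -mulmx_suml sdd mul0mx sub0r -addrA.
rewrite [X in _ = _ + X](_ : _ = 0) ?addr0 // -sum_mx11 mxE.
rewrite summxE -sumrN -big_split big1 // => i _ /=.
by rewrite -[X in - X + _]trmx11 !trmx_mul !trmxK addNr.
Qed.

Lemma hperp_seq_Pi :
  hseq (Pi_seq u) (Pi_seq v) - \sum_(1 <= i < n.+1)
    (Pi_seq u i%:Z *m B i%:Z *m (frame (i%:Z + 1))^T *m invmx (G i%:Z) *m
     (Pi_seq v i%:Z *m B i%:Z *m (frame (i%:Z + 1))^T)^T) 0 0 =
  hseq u v - (I *m Gbar n B w *m J^T) 0 0.
Proof.
rewrite hseq_Pi_seq -addrA; congr (_ + _).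
(* The product of [dc *m G - I] and [dd *m G - J] with respect to [invmx (G i)]. *)
have E0 i : Pi_seq u i *m B i *m (frame (i + 1))^T *m invmx (G i) *m
     (Pi_seq v i *m B i *m (frame (i + 1))^T)^T =
     dc i *m G i *m (dd i)^T - dc i *m J^T - I *m (dd i)^T + I *m invmx (G i) *m J^T.
  rewrite !Pi_seq_boundary !integrals_Pi_seq uI vJ !opprB mulmxBl mulmxK //.
  rewrite linearB /= trmx_mul trmx_G mulmxBl !mulmxBr !mulmxA mulmxKV //.
  by rewrite [- (_ - _)]opprD opprK addrA.
under [X in _ - X]eq_bigr do rewrite E0.
rewrite [X in _ - X]sum_mx11 big_split !sumrB /= -mulmx_suml sdc mul0mx subr0.
rewrite -mulmx_sumr -linear_sum /= sdd linear0 mulmx0 subr0.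
by rewrite -mulmx_suml -mulmx_sumr /Gbar -mx11B opprD addrA subrr sub0r mxE.
Qed.

End TwoPeriodic.

(** * The spaces Y, Z, Xperp and the projection *)

Lemma mem_Y (u : X) : reflect (forall i, integrals i (ext u) = integrals 1 (ext u))
  (u \in Y n B w).
Proof.
have lf j : linear (fun u : X => integrals j.+1%:Z (ext u) - integrals 1 (ext u)).
  by move=> c x y; rewrite !(ext_linear, integrals_linear) scalerBr opprD addrACA.
apply: (iffP (mem_bigcapv _ _)) => H i; last first.
  by rewrite memv_ker linfunE // H subrr.
move: i; apply: (periodic_eq n_gt0) => // [|j].
  exact/integrals_periodic/ext_periodic.
by have := H j; rewrite memv_ker linfunE // subr_eq0 => /eqP.
Qed.

Lemma mem_Y0 (u : X) : reflect (forall i, integrals i (ext u) = 0) (u \in Y0 n B w).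
Proof.
have lf j : linear (fun u : X => integrals j.+1%:Z (ext u)).
  by move=> c x y; rewrite ext_linear integrals_linear.
apply: (iffP (mem_bigcapv _ _)) => H i; last by rewrite memv_ker linfunE // H.
move: i; apply: (periodic_eq n_gt0) => // [|j].
  exact/integrals_periodic/ext_periodic.
by have := H j; rewrite memv_ker linfunE // => /eqP.
Qed.

Lemma mem_Xperp (v : X) : reflect (coef (ext v) = 0) (v \in Xperp n B w).
Proof.
pose b (j : int) u : 'rV[R]_k := \row_a pairing (B j) (w a j) (u (j + 1)).
have bE j u : b j u = u (j + 1) *m (B j)^T *m (frame j)^T.
  by apply/rowP => a; rewrite mxE entry_pairing row_frame row_id pairing_tr.
have lf (j : nat) : linear (fun u : X => \row_(a < k)
    pairing (B j%:Z) (w a j%:Z) (ext u j.+1%:Z)).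
  have E0 (u : X) : \row_(a < k) pairing (B j%:Z) (w a j%:Z) (ext u j.+1%:Z) = b j (ext u).
    by apply/rowP => a; rewrite !mxE -addn1 PoszD.
  by move=> c x y; rewrite !E0 !bE ext_linear !fctE !mulmxDl -!scalemxAl.
apply: (iffP (mem_bigcapv _ _)) => H.
  apply/funext; apply: (periodic_eq n_gt0) => [||j] //.
    exact/coef_periodic/ext_periodic.
  have := H j; rewrite memv_ker linfunE // => /eqP E0.
  suff: b j%:Z (ext v) = 0.
    rewrite bE /coef => E1; have -> : j.+1%:Z = j%:Z + 1 by rewrite -addn1 PoszD.
    by rewrite addrK E1 mul0mx.
  by rewrite -E0; apply/rowP => a; rewrite !mxE -addn1 PoszD.
move=> j; rewrite memv_ker linfunE //; apply/eqP.
have := @coef_eq0 (ext v) (j%:Z + 1); rewrite addrK H => /(_ erefl).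
by rewrite -bE => <-; apply/rowP => a; rewrite !mxE -addn1 PoszD.
Qed.

Notation Pi := (Pi n B w).

Lemma PiE (u : X) : Pi u = restr n (Pi_seq (ext u)).
Proof. by apply: linfunE => c x y; rewrite ext_linear Pi_seq_linear restr_linear. Qed.

Lemma ext_Pi (u : X) : ext (Pi u) = Pi_seq (ext u).
Proof. by rewrite PiE restrK //; exact/Pi_seq_periodic/ext_periodic. Qed.

(** Modulo the identification of [X] with periodic sequences, [Z] is the kernel of
    [Pi]. *)
Lemma mem_Z (u : X) : (u \in Z n w) = (u \in lker Pi).
Proof.
have lf (j : nat) : linear (fun u : X => ext u j.+1%:Z).
  by move=> c x y; rewrite ext_linear.
have spanE (j : 'I_n) (x : E) : reflect (exists r, x = r *m frame j.+1%:Z)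
    (x \in <<[seq w a j.+1%:Z | a : 'I_k]>>%VS).
  apply: (iffP (mem_span_family _ _)) => -[c ->]; exists c; rewrite mulmx_sum_row;
  by apply: eq_bigr => a _; rewrite row_frame.
apply/mem_bigcapv/idP => [H|].
  rewrite memv_ker PiE; apply/eqP/ffunP => j; rewrite !ffunE.
  have := H j; rewrite -memv_preim linfunE // => /spanE[c uE].
  have : Pi_seq (ext u) j.+1%:Z = Pi_seq (comb (fun=> c)) j.+1%:Z.
    by rewrite !Pi_seqE /coef /comb uE.
  by rewrite Pi_seq_comb.
rewrite memv_ker => /eqP E0 j; rewrite -memv_preim linfunE //; apply/spanE.
exists (coef (ext u) j.+1%:Z); rewrite {1}[ext u]Pi_seq_decomp -ext_Pi E0.
by rewrite ext0 add0r.
Qed.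

Lemma mem_Gamma (u : X) :
  reflect (exists r, ext u = comb (fun=> r)) (u \in Gamma n w).
Proof.
have E0 (r : 'rV[R]_k) : \sum_a r 0 a *: restr n (w a) = restr n (comb (fun=> r)).
  apply/ffunP => j; rewrite sum_ffunE ffunE /comb mulmx_sum_row.
  by apply: eq_bigr => a _; rewrite !ffunE row_frame.
apply: (iffP (mem_span_family _ _)) => -[r uE]; exists r.
  by rewrite uE E0 restrK //; exact: comb_periodic.
by rewrite E0 -uE extK.
Qed.

Lemma Gamma_sub_Y0 : (Gamma n w <= Y0 n B w)%VS.
Proof.
apply/subvP => u /mem_Gamma[r uE]; apply/mem_Y0 => i.
by rewrite uE integrals_comb subrr mul0mx.
Qed.

Lemma Y0_sub_Y : (Y0 n B w <= Y n B w)%VS.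
Proof. by apply/subvP => u /mem_Y0 u0; apply/mem_Y => i; rewrite !u0. Qed.

Lemma Gamma_sub_ker : (Gamma n w <= lker Pi)%VS.
Proof.
apply/subvP => u /mem_Gamma[r uE].
by rewrite memv_ker PiE uE Pi_seq_comb restr0.
Qed.

(** If [comb c] has constant integrals [I] then [I *m Gbar] is the sum of the
    increments of [c], that is 0; hence [c] is constant. *)
Lemma Y_cap_ker : (Y n B w :&: lker Pi <= Gamma n w)%VS.
Proof.
apply/subvP => u /memv_capP[/mem_Y uY]; rewrite memv_ker => /eqP Pu0.
pose c := coef (ext u); have pc : periodic n c.
  exact/coef_periodic/ext_periodic.
have uE : ext u = comb c.
  by rewrite {1}[ext u]Pi_seq_decomp -ext_Pi Pu0 ext0 add0r.
pose I := integrals 1 (ext u).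
have dcE i : c (i + 1) - c i = I *m invmx (G i).
  by rewrite /I -(uY i) uE integrals_comb mulmxK.
have I0 : I = 0.
  rewrite -[I](mulmxK Gbar_unit) /Gbar mulmx_sumr.
  under eq_bigr do rewrite -dcE.
  by rewrite sum_increments // mul0mx.
have cS i : c (i + 1) = c i by apply/eqP; rewrite -subr_eq0 dcE I0 mul0mx.
apply/mem_Gamma; exists (c 0); rewrite uE; apply/funext => i; congr (_ *m _).
by elim/int_step_ind: i => // i; rewrite cS.
Qed.

(** Every element of [X] can be moved into [Y] along [Z]. *)
Lemma Y_near (v : X) : exists2 u, u \in Y n B w & u - v \in lker Pi.
Proof.
(* The common value [I] of the integrals is fixed by the requirement that the
   increments [D] add up to 0. *)
pose I := (\sum_(1 <= i < n.+1) integrals i%:Z (ext v) *m invmx (G i%:Z))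
  *m invmx (Gbar n B w).
pose D i := (I - integrals i (ext v)) *m invmx (G i).
have [c [_ cS]] := @int_rec _ (fun i x => x + D i) (fun i x => x - D i) 0
  (fun i x => subrK _ x).
have dcE i : c (i + 1) - c i = D i by rewrite cS addrC addKr.
have pD : periodic n (fun i => c (i + 1) - c i).
  move=> i; rewrite !dcE /D G_periodic integrals_periodic //.
  exact: ext_periodic.
have pc : periodic n c.
  move=> i; rewrite sum_step // (eq_bigr (fun i : nat => D i%:Z)) => [|j _]; last first.
    exact: dcE.
  rewrite /D; under eq_bigr do rewrite mulmxBl.
  by rewrite sumrB -mulmx_sumr /I mulmxKV // subrr addr0.
have pcomb := comb_periodic pc.
exists (v + restr n (comb c)); last first.
  rewrite addrC addKr memv_ker PiE restrK // Pi_seq_comb.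
  by rewrite restr0.
suff H i : integrals i (ext (v + restr n (comb c))) = I.
  by apply/mem_Y => i; rewrite !H.
by rewrite extD integralsD restrK // integrals_comb dcE mulmxKV // subrKC.
Qed.

Lemma limg_Pi_Y : (Pi @: Y n B w)%VS = Xperp n B w.
Proof.
apply/vspaceP => v; apply/memv_imgP/mem_Xperp => [[u _ ->]|v0].
  by rewrite ext_Pi coef_Pi_seq.
have [u uY uv] := Y_near v; exists u => //.
have <- : Pi v = v.
  rewrite PiE Pi_seq_sub v0 -[RHS]extK; congr restr.
  by apply/funext => i; rewrite !fctE /comb mul0mx subr0.
by apply/eqP; rewrite eq_sym -subr_eq0 -linearB -memv_ker.
Qed.

(** * The decomposition *)

Lemma trmx_Gbar : (Gbar n B w)^T = Gbar n B w.
Proof.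
by rewrite /Gbar linear_sum; apply: eq_bigr => i _; rewrite /= trmx_inv trmx_G.
Qed.

Lemma trmx_kappa : (kappa n B w)^T = kappa n B w.
Proof. by rewrite /kappa trmx_inv trmx_Gbar. Qed.

Lemma h_hseq (u v : X) : h A B u v = hseq (ext u) (ext v).
Proof. by []. Qed.

Lemma hperp_Pi (u v : X) : u \in Y n B w -> v \in Y n B w ->
  hperp B w A (Pi u) (Pi v) =
  h A B u v - (integrals 1 (ext u) *m Gbar n B w *m (integrals 1 (ext v))^T) 0 0.
Proof.
move=> /mem_Y uY /mem_Y vY; rewrite hperpE !ext_Pi.
exact: hperp_seq_Pi (ext_periodic u) (ext_periodic v) uY vY.
Qed.

(** The trajectories [q a] are those dual to the [w a] in the generalized kernel;
    the translation by [n] acts on them as a Jordan block with matrix [S]. *)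
Section Jordan.
Variables (q : 'I_k -> int -> E) (S : 'M[R]_k).
Hypothesis q_traj : forall a, variation A B (q a) = 0.
Hypothesis q_shift : forall a i, q a (i + n%:Z) = q a i + row a S *m frame i.
Hypothesis wronskian_wq : forall a b, wronskian B (w a) (q b) 0 = (a == b)%:R.
Hypothesis S_sym : S^T = S.
Hypothesis Aperp_unit : S - Gbar n B w \in unitmx.
Notation kappa := (kappa n B w).
Notation qperp a := (restr n (Pi_seq (q a))).

Lemma integrals_q a i : integrals i (q a) = row a 1%:M.
Proof.
rewrite integrals_traj //; apply/rowP => b; rewrite integrals_wronskian wronskian_wq.
by rewrite !mxE eq_sym.
Qed.

(** A periodic sequence in [Y] which differs from the trajectory [q a] by a
    combination of the [w b]; [D] is the sequence of increments which compensates
    the shift of [q a] over a period. *)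
Lemma lift_exists a : exists u : X,
  [/\ u \in Y n B w, integrals 1 (ext u) = row a (1%:M - S *m kappa),
      Pi u = qperp a &
      forall y : X, y \in Y n B w ->
        h A B u y = - (row a S *m (integrals 1 (ext y))^T) 0 0].
Proof.
pose D i := - (row a S *m kappa *m invmx (G i)).
have [c [_ cS]] := @int_rec _ (fun i x => x + D i) (fun i x => x - D i) 0
  (fun i x => subrK _ x).
have dcE i : c (i + 1) - c i = D i by rewrite cS addrC addKr.
have pD : periodic n (fun i => c (i + 1) - c i).
  by move=> i; rewrite !dcE /D G_periodic.
have sD : \sum_(1 <= i < n.+1) (c (i%:Z + 1) - c i%:Z) = - row a S.
  under eq_bigr do rewrite dcE.
  by rewrite sumrN -mulmx_sumr /kappa mulmxKV.
have pu : periodic n (q a + comb c).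
  move=> i; rewrite !fctE q_shift /comb frame_periodic sum_step // sD mulmxDl.
  by rewrite addrACA mulNmx subrr addr0.
pose u := restr n (q a + comb c).
have uE : ext u = q a + comb c by rewrite restrK.
have uI i : integrals i (ext u) = row a (1%:M - S *m kappa).
  rewrite uE integralsD integrals_q integrals_comb dcE /D mulNmx mulmxKV //.
  by rewrite (linearB (row a)) /= row_mul.
exists u; split=> // [||y /mem_Y yY].
- by apply/mem_Y => i; rewrite !uI.
- by rewrite PiE uE Pi_seqD Pi_seq_comb addr0.
rewrite h_hseq uE hseqDl hseq_traj // add0r hseq_comb //; last exact: ext_periodic.
under eq_bigr do rewrite yY.
by rewrite sum_mx11 -mulmx_suml sD mulNmx mxE.
Qed.

Variables (Xhat : vectType R) (pi : 'Hom(X, Xhat)).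
Hypothesis pi_quotient : is_quotient pi (Gamma n w).
Notation qhat a := (class_near pi (Y n B w) (Z n w) (qperp a)).

(** A family of representatives of the classes [qhat a]. *)
Section Lift.
Variable lift : 'I_k -> X.
Hypothesis lift_Y : forall a, lift a \in Y n B w.
Hypothesis integrals_lift :
  forall a, integrals 1 (ext (lift a)) = row a (1%:M - S *m kappa).
Hypothesis Pi_lift : forall a, Pi (lift a) = qperp a.
Hypothesis h_lift : forall a (y : X), y \in Y n B w ->
  h A B (lift a) y = - (row a S *m (integrals 1 (ext y))^T) 0 0.
Notation Omega := <<[seq lift a | a : 'I_k]>>%VS.

Lemma lker_pi : lker pi = Gamma n w. Proof. by case: pi_quotient. Qed.

Lemma pi_eq (u v : X) : (pi u == pi v) = (u - v \in Gamma n w).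
Proof. by rewrite -lker_pi memv_ker linearB /= subr_eq0. Qed.

Lemma pi_section (u : X) : pi^-1%VF (pi u) - u \in Gamma n w.
Proof.
by rewrite -pi_eq limg_lfunVK //; have [_ ->] := pi_quotient; exact: memvf.
Qed.

Lemma Omega_sub_Y : (Omega <= Y n B w)%VS.
Proof. by apply/span_subvP => _ /mapP[a _ ->]. Qed.

(** This is where the nondegeneracy of [Aperp] is needed. *)
Lemma integrals_matrix_unit : 1%:M - S *m kappa \in unitmx.
Proof.
have -> : 1%:M - S *m kappa = - (S - Gbar n B w) *m kappa.
  by rewrite opprB mulmxBl /kappa mulmxV.
by rewrite unitmx_mul unitmx_inv Gbar_unit andbT -scaleN1r unitmxZ ?unitrN1.
Qed.

Lemma integrals_sum_lift (r : 'rV[R]_k) :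
  integrals 1 (ext (\sum_a r 0 a *: lift a)) = r *m (1%:M - S *m kappa).
Proof.
have [F FE] : exists F : {linear X -> 'rV[R]_k}, F =1 integrals 1 \o @ext R m n.
  by exists (integrals 1 \o @ext R m n).
rewrite -[LHS]FE linear_sum mulmx_sum_row; apply: eq_bigr => a _.
by rewrite linearZ /= FE /= integrals_lift.
Qed.

(** The integrals of the [lift a] form a basis, and [Y0] is their kernel on [Y]. *)
Lemma direct_sum_Y : direct_sum (Y n B w) Omega (Y0 n B w).
Proof.
split.
  apply/eqP; rewrite eqEsubv subv_add Omega_sub_Y Y0_sub_Y /=.
  apply/subvP => y yY; pose r := integrals 1 (ext y) *m invmx (1%:M - S *m kappa).
  pose o := \sum_a r 0 a *: lift a.
  have oO : o \in Omega by apply/mem_span_family; exists r.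
  rewrite -(subrKC o y) memv_add //; apply/mem_Y0 => i.
  have /mem_Y -> : y - o \in Y n B w by rewrite memvB // (subvP Omega_sub_Y).
  rewrite extB integralsB integrals_sum_lift mulmxKV ?subrr //.
  exact: integrals_matrix_unit.
apply/directv_addP/eqP; rewrite -subv0; apply/subvP => x /memv_capP[].
move=> /mem_span_family[r ->] /mem_Y0/(_ 1); rewrite integrals_sum_lift => r0.
have -> : r = 0 by rewrite -[r](mulmxK integrals_matrix_unit) r0 mul0mx.
by rewrite big1 ?mem0v // => a _; rewrite mxE scale0r.
Qed.

Lemma qhat_lift a : qhat a = pi (lift a).
Proof.
set Q := [set u : X | (u \in Y n B w) && (u - qperp a \in Z n w)]%classic.
have Pq : Pi (qperp a) = qperp a.
  rewrite -Pi_lift; apply: ext_inj.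
  by rewrite !ext_Pi Pi_seq_sub coef_Pi_seq; apply/funext => i; rewrite !fctE /comb mul0mx subr0.
have Q_lift : Q (lift a).
  by rewrite /Q /= lift_Y mem_Z memv_ker linearB /= Pq Pi_lift subrr.
have : Q (xget 0 Q) by apply: xgetPex; exists (lift a).
rewrite /class_near -/Q /= => /andP[uY].
rewrite mem_Z memv_ker linearB /= Pq -Pi_lift => uZ.
apply/eqP; rewrite pi_eq (subvP Y_cap_ker) // memv_cap memvB //=.
by rewrite memv_ker linearB.
Qed.

Lemma span_qhat : <<[seq qhat a | a : 'I_k]>>%VS = (pi @: Omega)%VS.
Proof.
rewrite limg_span -map_comp; congr span.
by apply: eq_map => a /=; exact: qhat_lift.
Qed.

Lemma span_qperp : <<[seq qperp a | a : 'I_k]>>%VS = (Pi @: Omega)%VS.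
Proof.
rewrite limg_span -map_comp; congr span.
by apply: eq_map => a /=; rewrite Pi_lift.
Qed.

Lemma Y_cap_lker_pi : (Y n B w :&: lker pi <= Y0 n B w)%VS.
Proof. by rewrite lker_pi (subv_trans (capvSr _ _)) // Gamma_sub_Y0. Qed.

Lemma direct_sum_hat :
  direct_sum (pi @: Y n B w)%VS <<[seq qhat a | a : 'I_k]>>%VS (pi @: Y0 n B w)%VS.
Proof. by rewrite span_qhat; exact: direct_sum_img direct_sum_Y Y_cap_lker_pi. Qed.

Lemma direct_sum_perp :
  direct_sum (Xperp n B w) <<[seq qperp a | a : 'I_k]>>%VS (X0perp n B w).
Proof.
rewrite span_qperp -limg_Pi_Y; apply: direct_sum_img direct_sum_Y _.
exact: subv_trans Y_cap_ker Gamma_sub_Y0.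
Qed.

Lemma Pihat_pi (u : X) : induced_map pi Pi (pi u) = Pi u.
Proof.
apply/eqP; rewrite comp_lfunE -subr_eq0 -linearB -memv_ker.
by rewrite (subvP Gamma_sub_ker) // pi_section.
Qed.

Lemma Pihat_iso (U : {vspace X}) : (U <= Y n B w)%VS ->
  restricts_to_iso (induced_map pi Pi) (pi @: U)%VS (Pi @: U)%VS.
Proof.
move=> UY; split.
  move=> _ _ /memv_imgP[u uU ->] /memv_imgP[v vU ->]; rewrite !Pihat_pi => E0.
  apply/eqP; rewrite pi_eq (subvP Y_cap_ker) // memv_cap (subvP UY) ?(memvB uU vU) //=.
  by rewrite memv_ker linearB /= E0 subrr.
rewrite -limg_comp.
apply/vspaceP => x; apply/memv_imgP/memv_imgP => -[u uU ->]; exists u => //;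
  by rewrite comp_lfunE Pihat_pi.
Qed.

Lemma h_Gamma_l (g u : X) : g \in Gamma n w -> h A B g u = 0.
Proof.
move=> /mem_Gamma[r gE]; rewrite h_hseq gE hseq_traj //; apply/funext => i.
by rewrite variation_comb !subrr !mul0mx subrr.
Qed.

Lemma h_sym (u v : X) : h A B u v = h A B v u.
Proof. by rewrite !h_hseq hseq_sym //; exact: ext_periodic. Qed.

Lemma hDl (u1 u2 v : X) : h A B (u1 + u2) v = h A B u1 v + h A B u2 v.
Proof. by rewrite !h_hseq extD hseqDl. Qed.

Lemma hhat_pi (u v : X) : induced_form pi (h A B) (pi u) (pi v) = h A B u v.
Proof.
have hG (u' u0 v0 : X) : u' - u0 \in Gamma n w -> h A B u' v0 = h A B u0 v0.
  by move=> gG; rewrite -(subrK u0 u') hDl h_Gamma_l // add0r.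
by rewrite /induced_form (hG _ u) ?pi_section // h_sym (hG _ v) ?pi_section // h_sym.
Qed.

Lemma hperp_Pi_Y0 (u v : X) : u \in Y n B w -> v \in Y0 n B w ->
  hperp B w A (Pi u) (Pi v) = h A B u v.
Proof.
move=> uY vY0; rewrite hperp_Pi // ?(subvP Y0_sub_Y) //.
by move/mem_Y0: vY0 => ->; rewrite trmx0 mulmx0 mxE subr0.
Qed.

Lemma h_lift_Y0 a (u : X) : u \in Y0 n B w -> h A B (lift a) u = 0.
Proof.
move=> uY0; rewrite h_lift ?(subvP Y0_sub_Y) //.
by move/mem_Y0: uY0 => ->; rewrite trmx0 mulmx0 mxE oppr0.
Qed.

Lemma row_tr_entry (M N : 'M[R]_k) a b :
  (M *m N^T) a b = (row a M *m (row b N)^T) 0 0.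
Proof. by rewrite !mxE; apply: eq_bigr => j _; rewrite !mxE. Qed.

Lemma h_lift_lift a b : h A B (lift a) (lift b) = (S *m kappa *m S - S) a b.
Proof.
rewrite h_lift // integrals_lift -row_tr_entry linearB /= trmx_mul trmx1 S_sym.
by rewrite trmx_kappa mulmxBr mulmx1 mulmxA !mxE opprB.
Qed.

Lemma hperp_qperp a b : hperp B w A (qperp a) (qperp b) = (S - Gbar n B w) a b.
Proof.
rewrite -!Pi_lift hperp_Pi // h_lift_lift !integrals_lift -row_mul -row_tr_entry.
have -> : (1%:M - S *m kappa) *m Gbar n B w *m (1%:M - S *m kappa)^T =
          Gbar n B w - S - S + S *m kappa *m S.
  rewrite linearB /= trmx_mul trmx1 S_sym trmx_kappa mulmxBl mul1mx mulmxKV //.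
  rewrite mulmxBr mulmx1 mulmxBl mulmxA /kappa mulmxV // mul1mx mulmxA.
  by rewrite opprB addrA addrAC -!addrA.
by move: (_ *m _ *m S) (Gbar n B w) => M1 M2; rewrite !mxE; ring.
Qed.

End Lift.

(** The reduction for any periodic linear system with the properties above, without
    reference to a Lagrangian. *)
Theorem splitting :
  let h := h A B in
  let hhat := induced_form pi h in
  let hperp := @Defs.hperp R m n k B w A in
  let Pihat := induced_map pi Pi in
  let Omegaperp := <<[seq qperp a | a : 'I_k]>>%VS in
  let Omegahat := <<[seq qhat a | a : 'I_k]>>%VS in
  (direct_sum (pi @: Y n B w)%VS Omegahat (pi @: Y0 n B w)%VS /\
   direct_sum (Xperp n B w) Omegaperp (X0perp n B w))
  /\
  (restricts_to_iso Pihat Omegahat Omegaperp /\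
   restricts_to_iso Pihat (pi @: Y0 n B w)%VS (X0perp n B w))
  /\
  ((forall u v : X, u \in Y0 n B w -> v \in Y0 n B w ->
      h u v = hperp (Pi u) (Pi v)) /\
   (forall u v : Xhat, u \in (pi @: Y0 n B w)%VS -> v \in (pi @: Y0 n B w)%VS ->
      hhat u v = hperp (Pihat u) (Pihat v)))
  /\
  ((forall u : X, u \in Y0 n B w -> forall a : 'I_k, hhat (qhat a) (pi u) = 0) /\
   (forall a b : 'I_k, hhat (qhat a) (qhat b) = (S *m kappa *m S - S) a b))
  /\
  ((forall u : X, u \in X0perp n B w -> forall a : 'I_k, hperp (qperp a) u = 0) /\
   (forall a b : 'I_k, hperp (qperp a) (qperp b) = (S - Gbar n B w) a b)).
Proof.
move=> h hhat hperp Pihat Omegaperp Omegahat.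
have [lift lift_spec] := choice lift_exists.
have lift_Y a : lift a \in Y n B w by case: (lift_spec a).
have lift_I a : integrals 1 (ext (lift a)) = row a (1%:M - S *m kappa).
  by case: (lift_spec a).
have lift_Pi a : Pi (lift a) = qperp a by case: (lift_spec a).
have lift_h a (y : X) : y \in Y n B w ->
    h (lift a) y = - (row a S *m (integrals 1 (ext y))^T) 0 0.
  by case: (lift_spec a) => _ _ _; exact.
have Y0_Y : (Y0 n B w <= Y n B w)%VS by exact: Y0_sub_Y.
split; first split.
- exact: (direct_sum_hat lift_Y lift_I lift_Pi).
- exact: (direct_sum_perp lift_Y lift_I lift_Pi).
split; first split.
- rewrite /Omegahat (span_qhat lift_Y lift_Pi) /Omegaperp (span_qperp lift_Pi).
  exact/Pihat_iso/Omega_sub_Y.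
- exact: Pihat_iso.
split; first split.
- by move=> u v uY0 vY0; rewrite /hperp hperp_Pi_Y0 // (subvP Y0_Y).
- move=> _ _ /memv_imgP[u uY0 ->] /memv_imgP[v vY0 ->].
  by rewrite /hhat hhat_pi /Pihat !Pihat_pi /hperp hperp_Pi_Y0 // (subvP Y0_Y).
split; first split.
- by move=> u uY0 a; rewrite /hhat (qhat_lift lift_Y lift_Pi) hhat_pi (h_lift_Y0 lift_h).
- move=> a b; rewrite /hhat !(qhat_lift lift_Y lift_Pi) hhat_pi.
  exact: (h_lift_lift lift_Y lift_I lift_h).
split.
- move=> _ /memv_imgP[u uY0 ->] a; rewrite /hperp -lift_Pi hperp_Pi_Y0 //.
  exact: (h_lift_Y0 lift_h).
- move=> a b; exact: (hperp_qperp lift_Y lift_I lift_Pi lift_h).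
Qed.

End Jordan.
End PeriodicVariations.

(** * The generalized kernel of P - I *)

Lemma ker_pow_stable (R : realType) (m r : nat)
    (T : 'End(('rV[R]_m * 'rV[R]_m)%type)) p :
  p \in ker_pow T r -> T p \in ker_pow T r.
Proof.
have iterE s p' : iter s (fun f => (T \o f)%VF) \1%VF p' = iter s T p'.
  by elim: s => [|s IH] /=; rewrite ?id_lfunE // comp_lfunE IH.
by rewrite !memv_ker !iterE -iterSr iterS => /eqP ->; rewrite linear0.
Qed.

Lemma sum_delta (R : nzRingType) (I : finType) (c : I -> R) (a : I) :
  \sum_b c b * (a == b)%:R = c a.
Proof.
rewrite (bigD1 a) //= eqxx mulr1 big1 ?addr0 // => b.
by rewrite eq_sym => /negPf ->; rewrite mulr0.
Qed.

Section GeneralizedKernel.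
Variables (R : realType) (m n k r : nat) (A B : int -> 'M[R]_m).
Hypothesis A_sym : forall i, (A i)^T = A i.
Hypothesis B_unit : forall i, B i \in unitmx.
Hypothesis A_periodic : periodic n A.
Hypothesis B_periodic : periodic n B.
Notation W := ('rV[R]_m * 'rV[R]_m)%type.
Notation P := (poincare A B n).
Notation V := (lker (P - \1%VF)).
Variables (w q : k.-tuple W) (Lc : {vspace W}).
Hypothesis V_isotropic : forall u v, u \in V -> v \in V -> omega B u v = 0.
Hypothesis w_basis : basis_of V w.
Hypothesis Lc_complement : direct_sum (ker_pow (P - \1%VF) r) V Lc.
Hypothesis q_basis : basis_of Lc q.
Hypothesis omega_wq :
  forall a b : 'I_k, omega B (tnth w a) (tnth q b) = (a == b)%:R.
Hypothesis omega_qq : forall a b : 'I_k, omega B (tnth q a) (tnth q b) = 0.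
Notation S := (\matrix_(a, b) coord w b (P (tnth q a) - tnth q a)).

Lemma poincare_fixed p : (p \in V) = (P p == p).
Proof. by rewrite memv_ker add_lfunE opp_lfunE id_lfunE subr_eq0. Qed.

Lemma w_in_V a : tnth w a \in V.
Proof. by apply: (basis_mem w_basis); rewrite mem_tnth. Qed.

Lemma omega_w_poincare_q a b : omega B (tnth w a) (P (tnth q b)) = (a == b)%:R.
Proof.
have /eqP wE : P (tnth w a) == tnth w a by rewrite -poincare_fixed w_in_V.
by rewrite -{1}wE (omega_poincare A_sym B_unit A_periodic B_periodic) omega_wq.
Qed.

(** The increment of [P] on the complement is orthogonal to [V] since [P] is
    symplectic and fixes [V]; as [V] is isotropic and dual to the [q b],
    such a vector of the generalized kernel lies in [V]. *)
Lemma poincare_increment a : P (tnth q a) - tnth q a \in V.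
Proof.
have [NE _] := Lc_complement.
pose T := P - \1%VF.
have TE p : T p = P p - p by rewrite add_lfunE opp_lfunE id_lfunE.
have : T (tnth q a) \in ker_pow T r.
  apply: ker_pow_stable; rewrite -NE (subvP (addvSr _ _)) //.
  by apply: (basis_mem q_basis); rewrite mem_tnth.
rewrite -NE TE => /memv_addP[v vV [l lL E0]]; rewrite E0.
suff -> : l = 0 by rewrite addr0.
rewrite (coord_basis q_basis lL) big1 // => b _.
suff -> : coord q b l = 0 by rewrite scale0r.
have : omega B (tnth w b) (P (tnth q a) - tnth q a) = 0.
  by rewrite omegaBr omega_w_poincare_q omega_wq subrr.
rewrite E0 omegaDr V_isotropic ?w_in_V // add0r.
rewrite {1}(coord_basis q_basis lL) omega_sumr.
under eq_bigr do rewrite -tnth_nth omega_wq.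
by rewrite sum_delta.
Qed.

Lemma poincare_q a : P (tnth q a) = tnth q a + \sum_b S a b *: tnth w b.
Proof.
rewrite -[LHS](subrKC (tnth q a)) [X in _ + X](coord_basis w_basis (poincare_increment a)).
by congr (_ + _); apply: eq_bigr => b _; rewrite mxE -tnth_nth.
Qed.

Lemma trmx_S : S^T = S.
Proof.
have omegaS p a : omega B p (P (tnth q a)) =
    omega B p (tnth q a) + \sum_b S a b * omega B p (tnth w b).
  by rewrite poincare_q omegaDr omega_sumr.
apply/matrixP => a b; rewrite [LHS]mxE.
have : omega B (P (tnth q b)) (P (tnth q a)) = 0.
  by rewrite (omega_poincare A_sym B_unit A_periodic B_periodic) omega_qq.
rewrite omegaS.
under eq_bigr do rewrite omega_antisym omega_w_poincare_q eq_sym mulrN.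
rewrite sumrN sum_delta omega_antisym omegaS omega_qq add0r.
under eq_bigr do rewrite omega_antisym omega_wq eq_sym mulrN.
by rewrite sumrN sum_delta opprK => /eqP; rewrite subr_eq0 => /eqP.
Qed.

Notation ws := (fun a => traj A B (tnth w a)).
Notation qs := (fun a => traj A B (tnth q a)).

Lemma ws_periodic a : periodic n (ws a).
Proof.
move=> i; have /eqP wE : P (tnth w a) == tnth w a by rewrite -poincare_fixed w_in_V.
by rewrite -[in RHS]wE traj_poincare.
Qed.

(** Over a period, the trajectory of [q a] is shifted by the combination of the
    [w b] with coefficients the row [a] of [S]. *)
Lemma qs_shift a i : qs a (i + n%:Z) = qs a i + row a S *m frame ws i.
Proof.
transitivity (traj A B (P (tnth q a)) i); first by rewrite traj_poincare.
have [F FE] := linear_bundled (traj_linear A B_unit).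
rewrite poincare_q -!FE linearD linear_sum /= fctE; congr (_ + _).
rewrite fct_sumE mulmx_sum_row; apply: eq_bigr => b _.
by rewrite linearZ /= row_frame FE [in RHS]mxE.
Qed.

End GeneralizedKernel.

(** * Discrete Lagrangian systems *)

Lemma opA_periodic (R : realType) (m : nat) (M : topologicalType)
    (mfd : manifold R m M) (L : M -> M -> R) (n : nat) (x : int -> M) :
  periodic n x -> periodic n (opA mfd L x).
Proof. by move=> px i; rewrite /opA px (addrAC i) px (addrAC i) px. Qed.

Lemma opB_periodic (R : realType) (m : nat) (M : topologicalType)
    (mfd : manifold R m M) (L : M -> M -> R) (n : nat) (x : int -> M) :
  periodic n x -> periodic n (opB mfd L x).
Proof. by move=> px i; rewrite /opB px (addrAC i) px. Qed.

Theorem theorem3p3 (R : realType) (m n k : nat) (M : topologicalType)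
    (mfd : manifold R m M) (L : M -> M -> R) (x : int -> M)
    (n_gt0 : (0 < n)%N)
    (L_lagrangian : discrete_lagrangian mfd L)
    (x_traj : periodic_trajectory mfd L n x)
    (B_nondegenerate : forall i, opB mfd L x i \in unitmx) :
  let A := opA mfd L x in
  let B := opB mfd L x in
  let P := poincare A B n in
  let V := lker (P - \1%VF) in
  let N := ker_pow (P - \1%VF) (2 * m) in
  forall
    (V_isotropic : forall u v, u \in V -> v \in V -> omega B u v = 0)
    (dimV : \dim V = k)
    (dimN : \dim N = (2 * k)%N)
    (w q : k.-tuple ('rV[R]_m * 'rV[R]_m)%type)
    (w_basis : basis_of V w)
    (Lc : {vspace ('rV[R]_m * 'rV[R]_m)%type})
    (Lc_complement : direct_sum N V Lc)
    (q_basis : basis_of Lc q)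
    (omega_wq : forall a b : 'I_k,
       omega B (tnth w a) (tnth q b) = (a == b)%:R)
    (omega_qq : forall a b : 'I_k, omega B (tnth q a) (tnth q b) = 0),
  let ws (a : 'I_k) := traj A B (tnth w a) in
  let S : 'M[R]_k := \matrix_(a, b) coord w b (P (tnth q a) - tnth q a) in
  let Aperp := S - Gbar n B ws in
  forall
    (G_nondegenerate : forall i, G B ws i \in unitmx)
    (Gbar_nondegenerate : Gbar n B ws \in unitmx)
    (Aperp_nondegenerate : Aperp \in unitmx)
    (Xhat : vectType R) (pi : 'Hom({ffun 'I_n -> 'rV[R]_m}, Xhat))
    (pi_quotient : is_quotient pi (Gamma n ws)),
  let Y := Y n B ws in
  let Y0 := Y0 n B ws in
  let Yhat := (pi @: Y)%VS in
  let Y0hat := (pi @: Y0)%VS in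
  let Xperp := Xperp n B ws in
  let X0perp := X0perp n B ws in
  let Pi := Pi n B ws in
  let Pihat := induced_map pi Pi in
  let h := @h R m n A B in
  let hhat := induced_form pi h in
  let hperp := @hperp R m n k B ws A in
  let Phi := class_near pi Y (Z n ws) in
  let qperp (a : 'I_k) := restr n (Pi_seq B ws (traj A B (tnth q a))) in
  let qhat (a : 'I_k) := Phi (qperp a) in
  let Omegaperp := <<[seq qperp a | a : 'I_k]>>%VS in
  let Omegahat := <<[seq qhat a | a : 'I_k]>>%VS in
  let a_ := S *m kappa n B ws *m S - S in
  (direct_sum Yhat Omegahat Y0hat /\ direct_sum Xperp Omegaperp X0perp)
  /\
  (restricts_to_iso Pihat Omegahat Omegaperp /\
   restricts_to_iso Pihat Y0hat X0perp)
  /\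
  ((forall u v, u \in Y0 -> v \in Y0 ->
      h u v = hperp (Pi u) (Pi v)) /\
   (forall u v, u \in Y0hat -> v \in Y0hat ->
      hhat u v = hperp (Pihat u) (Pihat v)))
  /\
  ((forall u, u \in Y0 -> forall a : 'I_k, hhat (qhat a) (pi u) = 0) /\
   (forall a b : 'I_k, hhat (qhat a) (qhat b) = a_ a b))
  /\
  ((forall u, u \in X0perp -> forall a : 'I_k, hperp (qperp a) u = 0) /\
   (forall a b : 'I_k, hperp (qperp a) (qperp b) = Aperp a b)).
Proof.
move=> A B P V N V_isotropic dimV dimN w q w_basis Lc Lc_complement q_basis
  omega_wq omega_qq ws S Aperp G_unit Gbar_unit Aperp_unit Xhat pi pi_quotient.
have A_sym i : (A i)^T = A i by exact: trmx_opA.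
have A_per : periodic n A by apply: opA_periodic; case: x_traj.
have B_per : periodic n B by apply: opB_periodic; case: x_traj.
have ws_per a : periodic n (ws a) by exact: ws_periodic w_basis a.
have ws_traj a : variation A B (ws a) = 0 by exact: variation_traj.
have ws_iso a b : wronskian B (ws a) (ws b) 0 = 0.
  by rewrite -omegaE // V_isotropic //; exact: w_in_V w_basis _.
pose qs a := traj A B (tnth q a).
have qs_traj a : variation A B (qs a) = 0 by exact: variation_traj.
have wq a b : wronskian B (ws a) (qs b) 0 = (a == b)%:R by rewrite -omegaE.
have shift a i : qs a (i + n%:Z) = qs a i + row a S *m frame ws i.
  exact: (qs_shift A_sym _ _ _ V_isotropic w_basis Lc_complement q_basis).
have S_sym : S^T = S.
  exact: (trmx_S A_sym _ _ _ V_isotropic w_basis Lc_complement q_basis).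
exact: (splitting n_gt0 A_sym B_per ws_per ws_traj ws_iso G_unit Gbar_unit
  qs_traj shift wq S_sym Aperp_unit pi_quotient).
Qed.
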